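(* Let $-\infty<a<b<\infty$. For each integer $n\ge1$ let $\mathrm{wce}(n)$ be the worst-case error in $H^1(a,b)$ of the Poincaré quadrature of $H^1(a,b)$ with $n$ nodes. Then $$\mathrm{wce}(n)=\left(\frac{\frac{b-a}{2n}}{\tanh\left(\frac{b-a}{2n}\right)}-1\right)^{1/2},$$ and it goes to zero at a linear speed when $n$ tends to infinity: $$\mathrm{wce}(n)\sim\frac{b-a}{2\sqrt3}\,\frac1n\qquad(n\to\infty).$$
   Context: Here $\mu$ is the uniform probability distribution on $[a,b]$, $d\mu=dx/(b-a)$, and $H^1(a,b)=H^1(\mu)=\{f\in L^2(\mu): f'\in L^2(\mu)\}$ (weak derivatives; elements identified with their continuous representatives), with norm $\|f\|_{H^1(\mu)}^2=\int_a^b f^2\,d\mu+\int_a^b (f')^2\,d\mu$. The Poincaré basis of $\mu$ is $\varphi_0=1$, $\varphi_m(x)=\sqrt2\cos\left(m\pi\frac{x-a}{b-a}\right)$ for $m\ge1$ (the $L^2(\mu)$-normalized Neumann eigenfunctions of $\varphi''=-\lambda\varphi$ on $[a,b]$). The Poincaré quadrature with $n$ nodes is the unique quadrature, consisting of $n$ nodes $x_1,\dots,x_n\in[a,b]$ and positive weights $w_1,\dots,w_n$, such that $\int_a^b\varphi_m\,d\mu=\sum_{i=1}^n w_i\varphi_m(x_i)$ for $0\le m\le 2n-1$ (existence and uniqueness are known because the Poincaré basis is, up to signs, a Tchebytchev system). Its worst-case error is $\mathrm{wce}(n)=\sup\left\{\left|\int_a^b h\,d\mu-\sum_{i=1}^n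 w_ih(x_i)\right|: h\in H^1(\mu),\ \|h\|_{H^1(\mu)}\le1\right\}$. The notation $u_n\sim v_n$ means $u_n/v_n\to1$. *)

(* Defs.v *)
From mathcomp Require Export all_boot all_order all_algebra.
From mathcomp Require Export all_classical all_reals all_analysis.

Set Implicit Arguments.
Unset Strict Implicit.
Unset Printing Implicit Defensive.
Import Order.TTheory GRing.Theory Num.Theory.
Import numFieldNormedType.Exports.

Local Open Scope classical_set_scope.
Local Open Scope ring_scope.

Definition tanh (R : realType) (x : R) : R :=
  (expR x - expR (- x)) / (expR x + expR (- x)).

(* C^oo functions with compact support in the open interval ]a, b[ *)
Definition test_function (R : realType) (a b : R) (phi : R -> R) : Prop :=
  [/\ forall (k : nat) (x : R), derivable (derive1n k phi) x 1,
      compact (closure [set x | phi x != 0]) &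
      closure [set x | phi x != 0] `<=` `]a, b[%classic].

(* Used only for f and g in L^2, so that both integrals converge. *)
Definition is_weak_derivative (R : realType) (a b : R) (f g : R -> R) : Prop :=
  forall phi : R -> R, test_function a b phi ->
    \int[lebesgue_measure]_(x in `]a, b[) (f x * derive1 phi x) =
    - \int[lebesgue_measure]_(x in `]a, b[) (g x * phi x).

(* f is the continuous representative of an element of H^1(a, b) with weak
   derivative g.  Functions are total on R, but uniform_prob ab is concentrated
   on [a, b] and no integral below sees the values outside [a, b].  As g is
   determined by f only almost everywhere, it is carried along explicitly. *)
Definition H1 (R : realType) (a b : R) (ab : a < b) (f g : R -> R) : Prop :=
  [/\ {within `[a, b], continuous f},
      f \in Lfun (uniform_prob ab) 2%:E,
      g \in Lfun (uniform_prob ab) 2%:E &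
      is_weak_derivative a b f g].

Definition H1_norm (R : realType) (a b : R) (ab : a < b) (f g : R -> R) : R :=
  Num.sqrt (\int[uniform_prob ab]_x (f x ^+ 2) +
            \int[uniform_prob ab]_x (g x ^+ 2)).

Definition poincare_basis (R : realType) (a b : R) (m : nat) (x : R) : R :=
  if m == 0%N then 1
  else Num.sqrt 2 * cos (m%:R * pi * ((x - a) / (b - a))).

Definition quadrature (R : realType) (n : nat) (x w : 'I_n -> R)
    (h : R -> R) : R :=
  \sum_(i < n) w i * h (x i).

(* For n >= 1 this determines the nodes x and weights w up to a common
   permutation of the indices. *)
Definition is_poincare_quadrature (R : realType) (a b : R) (ab : a < b)
    (n : nat) (x w : 'I_n -> R) : Prop :=
  [/\ injective x,
      forall i, a <= x i <= b,
      forall i, 0 < w i &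
      forall m : nat, (m <= 2 * n - 1)%N ->
        \int[uniform_prob ab]_t poincare_basis a b m t =
        quadrature x w (poincare_basis a b m)].

(* The supremum is taken in the extended reals, where it always exists. *)
Definition wce (R : realType) (a b : R) (ab : a < b)
    (n : nat) (x w : 'I_n -> R) : \bar R :=
  ereal_sup [set e : \bar R | exists h h' : R -> R,
    [/\ H1 ab h h', H1_norm ab h h' <= 1 &
        e = `| \int[uniform_prob ab]_t h t - quadrature x w h |%:E]].

(* Main.v *)
Require Import Defs.
From mathcomp Require Import all_boot all_order all_algebra.
From mathcomp Require Import all_classical all_reals all_analysis.
From mathcomp Require Import measurable_realfun.
From mathcomp Require Import ring lra zify.
Import Order.TTheory GRing.Theory Num.Theory.
Import numFieldNormedType.Exports.
Local Open Scope classical_set_scope.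
Local Open Scope ring_scope.

Set Implicit Arguments.
Unset Strict Implicit.
Unset Printing Implicit Defensive.

(** The conditions on the quadrature are moment conditions on the angles
    [theta_i = pi (x_i - a) / (b - a)], namely [sum_i w_i cos (m theta_i) = 0] for
    [0 < m < 2 n]: this is Gauss-Chebyshev quadrature.  By the product formula for
    cosines, the square matrix [cos (k theta_i)], [k < n], is invertible, being
    orthogonal up to diagonal factors.  As [w_i cos (n theta_i)] is orthogonal to
    all its rows, [cos (n theta_i) = 0]; the diagonal of the inverse then gives
    [w_i = 1/n].  So the quadrature is the midpoint rule for [n] cells of width
    [(b - a) / n] ([poincare_quadratureE]).

    The error functional [h |-> int h dmu - Q h] of the midpoint rule is
    represented in [H^1] by an explicit function [K].  It solves [K - K'' = 1] away
    from the nodes, with [K' = 0] at the cell boundaries and a jump of [K'] at each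
    node that produces the point evaluation.  With [l = (b - a) / (2 n)], this gives
    [K = 1 - A cosh s], where [s] is the distance to the nearest cell boundary and
    [A sinh l = l].  By the Cauchy-Schwarz inequality the worst-case error is the
    norm of [K], attained at a multiple of [K].  Pairing [K] with the constant [1],
    which the rule integrates exactly, shows that [int K dmu = 0], so that
    [||K||^2 = <K, K> = - Q K = A cosh l - 1 = l / tanh l - 1]
    ([H1_dot_kernel_kernel], [wce_midpoint]).

    Analytically, the point is to integrate by parts on a cell [[c, d]] when [h'] is
    only a weak derivative, known through smooth functions with compact support
    ([weak_integration_by_parts]).  The weak derivative is tested against a smooth
    function times a smooth approximation of the indicator function of [[c, d]],
    built from [exp (-1/t)].  Where the approximation rises and falls, its derivative
    is an approximate identity, and produces the boundary terms in the limit.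
    Conversely, that a continuous, piecewise smooth function is in [H^1] follows from
    the fundamental theorem of calculus on each piece and telescoping
    ([weak_derivative_glue]).

    The asymptotics follow from
    [1 / cosh l <= 3 (l / tanh l - 1) / l^2 <= cosh l] ([coth_bounds]). *)

(** * Smooth functions *)

(** The derivatives are asked to exist rather than named, so that the closure
    properties below are proved by induction with [is_derive] alone, without
    computing iterated derivatives. *)
Fixpoint times_derivable (R : realType) (n : nat) (f : R -> R) : Prop :=
  if n is m.+1 then
    exists2 df : R -> R, (forall x : R, is_derive x 1 f (df x)) & times_derivable m df
  else True.

Definition smooth (R : realType) (f : R -> R) : Prop :=
  forall n, times_derivable n f.

Section Smooth.
Context {R : realType}.
Implicit Types (f g : R -> R) (n : nat) (x : R).

Lemma times_derivableW n f : times_derivable n.+1 f -> times_derivable n f.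
Proof.
elim: n f => [//|n IH] f [df fdf dfn].
by exists df => //; exact: IH.
Qed.

Lemma times_derivable_cst n (c : R) : times_derivable n (fun=> c).
Proof.
elim: n c => [//|n IH] c; exists (fun=> 0); last exact: IH.
by move=> x; exact: is_derive_cst.
Qed.

Lemma times_derivableD n f g : times_derivable n f -> times_derivable n g ->
  times_derivable n (fun x => f x + g x).
Proof.
elim: n f g => [//|n IH] f g [df fdf dfn] [dg gdg dgn].
exists (fun x => df x + dg x); last exact: IH.
by move=> x; apply: is_deriveD.
Qed.

Lemma times_derivableM n f g : times_derivable n f -> times_derivable n g ->
  times_derivable n (fun x => f x * g x).
Proof.
elim: n f g => [//|n IH] f g /[dup] /times_derivableW fn [df fdf dfn]
  /[dup] /times_derivableW gn [dg gdg dgn].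
exists (fun x => f x * dg x + g x * df x); last first.
  by apply: times_derivableD; exact: IH.
by move=> x; exact: is_deriveM.
Qed.

Lemma times_derivableV n f : (forall x, f x != 0) -> times_derivable n f ->
  times_derivable n (fun x => (f x)^-1).
Proof.
move=> f0; elim: n => [//|n IH] /[dup] /times_derivableW/IH fn [df fdf dfn].
exists (fun x => -1 * ((f x)^-1 * (f x)^-1) * df x); last first.
  apply: times_derivableM => //; apply: times_derivableM.
    exact: times_derivable_cst.
  exact: times_derivableM.
move=> x; apply: (is_derive_eq (is_deriveV (f0 x) (fdf x))).
by rewrite /GRing.scale/= mulN1r -invfM expr2.
Qed.

Lemma times_derivable_affine n f (u v : R) : times_derivable n f ->
  times_derivable n (fun x => f (u * x + v)).
Proof.
elim: n f => [//|n IH] f [df fdf dfn].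
exists (fun x => df (u * x + v) * u); last first.
  by apply: times_derivableM; [exact: IH|exact: times_derivable_cst].
move=> x; apply: (@is_derive1_comp _ f (fun x => u * x + v)).
apply: is_derive_eq.
by rewrite /GRing.scale/= addr0 mulr1.
Qed.

Lemma smooth_derivable f (k : nat) x : smooth f -> derivable (derive1n k f) x 1.
Proof.
move=> /(_ k.+1); elim: k f x => [|k IH] f x [df fdf dfn].
  exact: ex_derive.
rewrite derive1Sn; suff -> : derive1 f = df by exact: IH.
by apply/funext => y; rewrite derive1E; exact: derive_val.
Qed.

Lemma smooth_derive1 f : smooth f -> smooth (derive1 f).
Proof.
move=> sf n; have [df fdf dfn] := sf n.+1.
suff -> : derive1 f = df by [].
by apply/funext => y; rewrite derive1E; exact: derive_val.
Qed.

Lemma smooth_is_derive f x : smooth f -> is_derive x 1 f (derive1 f x).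
Proof. by move=> /(@smooth_derivable f 0 x) df; rewrite derive1E; exact: derivableP. Qed.

Lemma derivable_continuous_at f x : derivable f x 1 -> {for x, continuous f}.
Proof. by move=> df; apply/differentiable_continuous/derivable1_diffP. Qed.

Lemma smooth_continuous f : smooth f -> continuous f.
Proof. by move=> sf x; exact/derivable_continuous_at/(@smooth_derivable f 0). Qed.

Lemma smooth_cst (c : R) : smooth (fun=> c).
Proof. by move=> n; exact: times_derivable_cst. Qed.

Lemma smoothD f g : smooth f -> smooth g -> smooth (fun x => f x + g x).
Proof. by move=> sf sg n; exact: times_derivableD. Qed.

Lemma smoothM f g : smooth f -> smooth g -> smooth (fun x => f x * g x).
Proof. by move=> sf sg n; exact: times_derivableM. Qed.

Lemma smooth_affine f (u v : R) : smooth f -> smooth (fun x => f (u * x + v)).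
Proof. by move=> sf n; exact: times_derivable_affine. Qed.

Lemma smooth_expR : smooth (@expR R).
Proof. by elim=> [//|n IH]; exists expR => // x; exact: is_derive_expR. Qed.

(** The functions [t^-k exp(-1/t)], extended by [0] to [t <= 0]: the linear span
    of this family is stable under derivation, hence made of smooth functions. *)
Definition flat (k : nat) (t : R) : R :=
  if 0 < t then t^-1 ^+ k * expR (- t^-1) else 0.

Lemma flat_ge0 k t : 0 <= flat k t.
Proof.
rewrite /flat; case: ifPn => // t0.
by rewrite mulr_ge0 ?expR_ge0// exprn_ge0// invr_ge0 ltW.
Qed.

Lemma flat_gt0 k t : 0 < t -> 0 < flat k t.
Proof. by move=> t0; rewrite /flat t0 mulr_gt0 ?expR_gt0// exprn_gt0// invr_gt0. Qed.

Lemma flat_le0 k t : t <= 0 -> flat k t = 0.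
Proof. by rewrite /flat ltNge => ->. Qed.

Lemma flat_div k t : flat k t = flat k.+1 t * t.
Proof.
rewrite /flat; case: ifPn; rewrite ?mul0r// => t0.
by rewrite mulrAC exprSr -[_ * t^-1 * t]mulrA mulVf ?gt_eqF// mulr1.
Qed.

(** Because [u^(k+1) / (k+1)! <= exp u] for [u = 1/t]; this makes [flat k]
    continuous at [0] and, with [flat_div], differentiable there. *)
Lemma flat_le k t : `|flat k t| <= k.+1`!%:R * `|t|.
Proof.
rewrite ger0_norm ?flat_ge0//.
have [t0|t0] := leP t 0; first by rewrite flat_le0// mulr_ge0.
rewrite flat_div gtr0_norm// ler_wpM2r ?(ltW t0)// /flat t0/=.
rewrite expRN ler_pdivrMr ?expR_gt0// -ler_pdivrMl ?ltr0n ?fact_gt0//.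
have t1 : 0 <= t^-1 by rewrite invr_ge0 ltW.
by apply: le_trans (expR_ge1Dxn k t1); rewrite mulrC lerDr.
Qed.

Lemma is_derive_flat (k : nat) (t : R) :
  is_derive t 1 (flat k) (flat k.+2 t - k%:R * flat k.+1 t).
Proof.
have [t0|t0|->] := ltgtP t 0.
- rewrite !flat_le0 ?ltW// mulr0 subr0.
  apply: (near_eq_is_derive _ (is_derive_cst (0 : R) t 1)).
  near=> z; rewrite flat_le0// ltW//.
  by near: z; exact: lt_nbhsl.
- have dV : is_derive t 1 (fun y : R => y^-1) (- t ^- 2).
    have t0' : id t != 0 by rewrite gt_eqF.
    apply: (is_derive_eq (is_deriveV t0' (is_derive_id t 1))).
    by rewrite /GRing.scale/= mulr1.
  have dX : is_derive t 1 (fun y : R => y^-1 ^+ k) (- (k%:R * t^-1 ^+ k.+1)).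
    case: k => [|k]; first by rewrite mul0r oppr0; exact: is_derive_cst.
    have -> : (fun y : R => y^-1 ^+ k.+1) = (fun y : R => y^-1) ^+ k.+1.
      by apply/funext => y; rewrite exprfctE.
    apply: (is_derive_eq (is_deriveX k.+1 dV)).
    by rewrite /GRing.scale/= -exprVn mulrN !exprS; congr (- _); ring.
  have dE : is_derive t 1 (fun y : R => expR (- y^-1)) (expR (- t^-1) * t ^- 2).
    have dN : is_derive t 1 (fun y : R => - y^-1) (t ^- 2).
      by apply: (is_derive_eq (is_deriveN dV)); rewrite opprK.
    exact: (@is_derive1_comp _ expR (fun y => - y^-1) t _ _ _ dN).
  have D : is_derive t 1 (fun y : R => y^-1 ^+ k * expR (- y^-1))
      (flat k.+2 t - k%:R * flat k.+1 t).
    apply: (is_derive_eq (is_deriveM dX dE)).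
    by rewrite /flat t0 /GRing.scale/= -exprVn !exprS; ring.
  apply: (near_eq_is_derive _ D); near=> z; rewrite /flat ifT//.
  by near: z; exact: lt_nbhsr.
- (* the slope of [flat k] between [0] and [t] is [flat k.+1 t] *)
  rewrite !flat_le0// mulr0 subr0; apply/is_derive1_caratheodory.
  exists (flat k.+1); split.
  + by move=> z; rewrite [flat k 0]flat_le0// !subr0 -flat_div.
  + rewrite /prop_for /continuous_at [flat _ 0]flat_le0//; apply/cvgr0Pnorm_lt => e e0.
    near=> z; apply: (le_lt_trans (flat_le _ _)).
    rewrite -ltr_pdivlMl ?ltr0n ?fact_gt0//; near: z.
    have := @cvg_id _ (nbhs (0 : R)) => /cvgr0Pnorm_lt; apply.
    by rewrite mulr_gt0// invr_gt0 ltr0n fact_gt0.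
  + by rewrite flat_le0.
Unshelve. all: by end_near. Qed.

Lemma smooth_flat k : smooth (flat k).
Proof.
move=> n; elim: n k => [//|n IH] k.
exists (fun t => flat k.+2 t + (- k%:R) * flat k.+1 t).
  by move=> t; apply: (is_derive_eq (is_derive_flat k t)); rewrite mulNr.
apply: times_derivableD => //; apply: times_derivableM => //.
exact: times_derivable_cst.
Qed.

(** The denominator never vanishes because [t] and [1 - t] cannot both be
    nonpositive; the quotient is [0] for [t <= 0] and [1] for [1 <= t]. *)
Definition smooth_step (t : R) : R := flat 0 t / (flat 0 t + flat 0 (1 - t)).

Definition smooth_step' (t : R) : R :=
  (flat 2 t * flat 0 (1 - t) + flat 0 t * flat 2 (1 - t)) /
  (flat 0 t + flat 0 (1 - t)) ^+ 2.

Let denom_gt0 t : 0 < flat 0 t + flat 0 (1 - t).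
Proof.
have [t0|t0] := ltP 0 t.
  by rewrite (lt_le_trans (flat_gt0 0 t0))// lerDl flat_ge0.
by rewrite ltr_wpDl ?flat_ge0// flat_gt0// subr_gt0 (le_lt_trans t0).
Qed.

Let smooth_flipped k : smooth (fun t => flat k (1 - t)).
Proof.
rewrite (_ : (fun _ => _) = fun t => flat k ((-1) * t + 1)); last first.
  by apply/funext => t; rewrite mulN1r addrC.
by apply: smooth_affine; exact: smooth_flat.
Qed.

Lemma smooth_smooth_step : smooth smooth_step.
Proof.
move=> n; apply: times_derivableM; first exact: smooth_flat.
apply: times_derivableV; first by move=> t; rewrite gt_eqF.
by apply: times_derivableD; [exact: smooth_flat|exact: smooth_flipped].
Qed.

Lemma is_derive_smooth_step (t : R) : is_derive t 1 smooth_step (smooth_step' t).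
Proof.
have d0 : is_derive t 1 (flat 0) (flat 2 t).
  by apply: (is_derive_eq (is_derive_flat 0 t)); rewrite mul0r subr0.
have d1 : is_derive t 1 (fun t => flat 0 (1 - t)) (- flat 2 (1 - t)).
  have df := is_derive_flat 0 (1 - t).
  have dB : is_derive t 1 (fun t => 1 - t) (-1 : R).
    have d := is_deriveB (is_derive_cst (1 : R) t 1) (is_derive_id t 1).
    by apply: (is_derive_eq d); rewrite sub0r.
  have := @is_derive1_comp _ (flat 0) (fun t => 1 - t) t _ _ df dB.
  move=> dc; apply: (is_derive_eq dc).
  by rewrite mul0r subr0 mulrN1.
have n0 : flat 0 t + flat 0 (1 - t) != 0 by rewrite gt_eqF.
have dD : is_derive t 1 (fun t => flat 0 t + flat 0 (1 - t))
  (flat 2 t - flat 2 (1 - t)) by exact: is_deriveD d0 d1.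
have dV := @is_deriveV _ (fun t => flat 0 t + flat 0 (1 - t)) t _ 1 n0 dD.
apply: (is_derive_eq (is_deriveM d0 dV)).
by rewrite /GRing.scale/= /smooth_step'; field.
Qed.

Lemma smooth_step'_ge0 t : 0 <= smooth_step' t.
Proof. by rewrite divr_ge0 ?sqr_ge0// addr_ge0// mulr_ge0// flat_ge0. Qed.

Lemma smooth_step'_ge1_eq0 t : 1 <= t -> smooth_step' t = 0.
Proof.
move=> t1; rewrite /smooth_step' ![flat _ (1 - t)]flat_le0 ?subr_le0//.
by rewrite !mulr0 addr0 mul0r.
Qed.

Lemma smooth_step'_le0_eq0 t : t <= 0 -> smooth_step' t = 0.
Proof. by move=> t0; rewrite /smooth_step' ![flat _ t]flat_le0// !mul0r addr0 mul0r. Qed.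

Lemma smooth_step_le0 t : t <= 0 -> smooth_step t = 0.
Proof. by move=> t0; rewrite /smooth_step flat_le0// mul0r. Qed.

Lemma smooth_step_ge1 t : 1 <= t -> smooth_step t = 1.
Proof.
move=> t1; rewrite /smooth_step [flat _ (1 - t)]flat_le0 ?subr_le0//.
by rewrite addr0 divff// gt_eqF// flat_gt0// (lt_le_trans _ t1).
Qed.

Lemma smooth_step_ge0 t : 0 <= smooth_step t.
Proof. by rewrite divr_ge0 ?flat_ge0// ltW. Qed.

Lemma smooth_step_le1 t : smooth_step t <= 1.
Proof. by rewrite ler_pdivrMr// mul1r lerDl flat_ge0. Qed.

End Smooth.

(** * Integration by parts against smooth functions *)

Section RealIntegrals.
Context {R : realType}.
Implicit Types (f g h v psi : R -> R) (a b c d : R).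
Local Notation mu := (@lebesgue_measure R).

Lemma within_continuous_integrable c d v : {within `[c, d], continuous v} ->
  mu.-integrable `[c, d] (EFin \o v).
Proof. by move=> cv; apply: continuous_compact_integrable => //; exact: segment_compact. Qed.

Lemma integrable_continuousM c d f v : {within `[c, d], continuous v} ->
  mu.-integrable `[c, d] (EFin \o f) ->
  mu.-integrable `[c, d] (EFin \o (fun t => f t * v t)).
Proof.
move=> cv fi; apply: (integrableMl _ fi) => //.
- exact: subspace_continuous_measurable_fun.
- have /compact_bounded[M [_ vM]] := continuous_compact cv (@segment_compact _ c d).
  by exists M; split; rewrite ?num_real// => ? ? ? ?; exact: vM.
Qed.

Lemma integrable_oo c d f : mu.-integrable `[c, d] (EFin \o f) ->
  mu.-integrable `]c, d[ (EFin \o f).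
Proof. by apply: integrableS => //; exact: subset_itv_oo_cc. Qed.


Lemma Rintegral_oo_cc c d f : mu.-integrable `[c, d] (EFin \o f) ->
  \int[mu]_(t in `]c, d[) f t = \int[mu]_(t in `[c, d]) f t.
Proof.
move=> fi; rewrite Rintegral_itv_obnd_cbnd; last exact: integrable_oo.
rewrite Rintegral_itv_bndo_bndc//.
by apply: integrableS fi => //; exact: subset_itv_co_cc.
Qed.

Lemma Rintegral_supported (A B : set R) f : B `<=` A ->
  (forall t, A t -> ~ B t -> f t = 0) ->
  \int[mu]_(t in A) f t = \int[mu]_(t in B) f t.
Proof.
move=> BA f0; rewrite -[in RHS](setIidr BA) Rintegral_mkcondr.
apply: eq_Rintegral => t; rewrite inE /patch => At.
by case: ifPn => //; rewrite notin_setE => /f0 ->.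
Qed.

Lemma Rintegral_derivative c d f f' : c < d ->
  (forall t : R, is_derive t 1 f (f' t)) -> continuous f' ->
  \int[mu]_(t in `[c, d]) f' t = f d - f c.
Proof.
move=> cd ff' cf'; rewrite /Rintegral (@continuous_FTC2 _ f' f)//.
- exact: continuous_subspaceT.
- have cf t : {for t, continuous f} by apply: derivable_continuous_at; exact: ex_derive.
  split; first by move=> t _; exact: ex_derive.
  + exact/cvg_at_right_filter/cf.
  + exact/cvg_at_left_filter/cf.
- by move=> t _; rewrite derive1E; exact: derive_val.
Qed.

(** The mass of [sigma k] concentrates at [z], where [v] is nearly constant. *)
Lemma approximate_identity c d z v (sigma : nat -> R -> R) : c <= z <= d ->
  {within `[c, d], continuous v} -> (forall k, continuous (sigma k)) ->
  (forall k t, 0 <= sigma k t) ->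
  (forall k, \int[mu]_(t in `[c, d]) sigma k t = 1) ->
  (forall delta, 0 < delta -> \forall k \near \oo, forall t, c <= t <= d ->
     delta <= `|t - z| -> sigma k t = 0) ->
  \int[mu]_(t in `[c, d]) (v t * sigma k t) @[k --> \oo] --> v z.
Proof.
move=> zcd cv csigma sigma0 sigma1 sigmaz; apply/cvgrPdist_le => e e0.
have /subspace_continuousP/(_ z) := cv.
rewrite /= in_itv/= => /(_ zcd) /cvgrPdist_le/(_ e e0).
rewrite near_withinE => -[delta /= delta0 vz].
have isigma k : mu.-integrable `[c, d] (EFin \o sigma k).
  by apply: within_continuous_integrable; exact: continuous_subspaceT.
near=> k.
have iv : mu.-integrable `[c, d] (EFin \o (fun t => v z - v t)).
  apply: within_continuous_integrable => t.
  by apply: continuousB; [exact: cst_continuous|exact: cv].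
have ivs : mu.-integrable `[c, d] (EFin \o (fun t => (v z - v t) * sigma k t)).
  by apply: integrable_continuousM => //; exact: continuous_subspaceT.
have -> : v z - \int[mu]_(t in `[c, d]) (v t * sigma k t) =
    \int[mu]_(t in `[c, d]) ((v z - v t) * sigma k t).
  rewrite -[v z in LHS]mulr1 -(sigma1 k) -RintegralZl// -RintegralB//.
  - by apply: eq_Rintegral => t _; rewrite mulrBl.
  - exact: (integrableZl _ (v z) (isigma k)).
  - apply: integrable_continuousM; first exact: continuous_subspaceT.
    exact: within_continuous_integrable.
apply: (le_trans (le_normr_Rintegral _ ivs)) => //.
rewrite -[leRHS]mulr1 -(sigma1 k) -RintegralZl//.
apply: le_Rintegral => //.
- exact: (integrable_norm ivs).
- exact: (integrableZl _ e (isigma k)).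
- move=> t tcd; rewrite normrM (ger0_norm (sigma0 k t)).
  have [tz|tz] := ltP `|t - z| delta.
    by rewrite ler_wpM2r//; apply: vz => //=; rewrite distrC.
  suff -> : sigma k t = 0 by rewrite !mulr0.
  move: tz; move: tcd; rewrite /= in_itv/=; move: t.
  by near: k; exact: sigmaz.
Unshelve. all: by end_near. Qed.

End RealIntegrals.

Section WeakDerivative.
Context {R : realType}.
Implicit Types (f g h v psi : R -> R) (a b c d : R).
Local Notation mu := (@lebesgue_measure R).

Let step (u v : R) (t : R) : R := smooth_step (u * t + v).
Let step' (u v : R) (t : R) : R := u * smooth_step' (u * t + v).

Let is_derive_step (u v t : R) : is_derive t 1 (step u v) (step' u v t).
Proof.
have da : is_derive t 1 (fun t => u * t + v) u.
  by apply: is_derive_eq; rewrite /GRing.scale/= addr0 mulr1.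
have ds := is_derive_smooth_step (u * t + v).
have dc := @is_derive1_comp _ smooth_step (fun t => u * t + v) t _ _ ds da.
by apply: (is_derive_eq dc); rewrite mulrC.
Qed.

Let smooth_step_uv (u v : R) : smooth (step u v).
Proof. by apply: smooth_affine; exact: smooth_smooth_step. Qed.

Let continuous_step' (u v : R) : continuous (step' u v).
Proof.
rewrite (_ : step' u v = derive1 (step u v)).
  by apply: smooth_continuous; exact: smooth_derive1.
by apply/funext => t; rewrite derive1E; apply/esym; exact: derive_val.
Qed.

Let Rintegral_step' (u v c d : R) : c < d -> u * c + v <= 0 -> 1 <= u * d + v ->
  \int[mu]_(t in `[c, d]) step' u v t = 1.
Proof.
move=> cd uc ud.
rewrite (Rintegral_derivative cd (is_derive_step u v) (@continuous_step' u v)).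
by rewrite /step smooth_step_ge1// smooth_step_le0// subr0.
Qed.

(** The weak derivative is tested against [psi] times cut-off functions that vanish
    near [c] and [d], which are test functions even when [c = a] or [d = b].  They
    tend to [1] on [`]c, d[], and their derivatives to the difference of the Dirac
    masses at [c] and [d]. *)
Lemma weak_integration_by_parts a b c d f g psi : a <= c -> c < d -> d <= b ->
  {within `[a, b], continuous f} -> mu.-integrable `[a, b] (EFin \o g) ->
  is_weak_derivative a b f g -> smooth psi ->
  \int[mu]_(t in `]c, d[) (g t * psi t + f t * derive1 psi t) =
  f d * psi d - f c * psi c.
Proof.
move=> ac cd db cfab gab fg spsi.
have cdab : `[c, d] `<=` `[a, b].
  by move=> t /=; rewrite !in_itv/= => /andP[? ?]; apply/andP; split; lra.
have cf : {within `[c, d], continuous f} := continuous_subspaceW cdab cfab.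
have ig : mu.-integrable `[c, d] (EFin \o g) by exact: integrableS gab.
have cpsi : {within `[c, d], continuous psi}.
  by apply: continuous_subspaceT; exact: smooth_continuous.
have cpsi' : {within `[c, d], continuous (derive1 psi)}.
  by apply: continuous_subspaceT; apply: smooth_continuous; exact: smooth_derive1.
(* The cut-off [s k] rises from [0] to [1] between [c + 1 / u k] and
   [c + 2 / u k], and falls back between [d - 2 / u k] and [d - 1 / u k];
   [+ 4] makes the first range end no later than the second one starts. *)
pose u (k : nat) : R := (k%:R + 4) / (d - c).
have dc0 : 0 < d - c by rewrite subr_gt0.
have u0 k : 0 < u k by rewrite divr_gt0// ltr_wpDl.
have ucd k : u k * (d - c) = k%:R + 4 by rewrite divfK// gt_eqF.
pose v1 k := - (u k * c) - 1; pose v2 k := - (u k * d) + 2.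
pose s k t := step (u k) (v1 k) t - step (u k) (v2 k) t.
pose s' k t := step' (u k) (v1 k) t - step' (u k) (v2 k) t.
have s'E k (t : R) : is_derive t 1 (s k) (s' k t).
  exact: (is_deriveB (is_derive_step _ _ _) (is_derive_step _ _ _)).
have ss k : smooth (s k).
  rewrite (_ : s k = fun t => step (u k) (v1 k) t + (-1) * step (u k) (v2 k) t).
    by apply: smoothD => //; apply: smoothM => //; exact: smooth_cst.
  by apply/funext => t; rewrite mulN1r.
have e1 k t : u k * t + v1 k = u k * (t - c) - 1 by rewrite /v1; ring.
have e2 k t : u k * t + v2 k = u k * (t - d) + 2 by rewrite /v2; ring.
have k0 (k : nat) : 0 <= k%:R :> R by [].
have eL k t : u k * (t - c) <= 1 -> s k t = 0 /\ s' k t = 0.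
  move=> tc; have td : u k * (t - d) + 2 <= 0.
    by have := ucd k; have := k0 k; lra.
  rewrite /s /s' /step /step' !e1 !e2 !smooth_step_le0 ?subr_le0//.
  rewrite !smooth_step'_le0_eq0 ?subr_le0//.
  by rewrite mulr0 subr0.
have eR k t : - 1 <= u k * (t - d) -> s k t = 0 /\ s' k t = 0.
  move=> tc; have td : 1 <= u k * (t - c) - 1.
    by have := ucd k; have := k0 k; lra.
  rewrite /s /s' /step /step' !e1 !e2.
  have td2 : 1 <= u k * (t - d) + 2 by lra.
  rewrite !smooth_step_ge1// !smooth_step'_ge1_eq0//.
  by rewrite mulr0 !subrr.
pose phi k t := psi t * s k t.
have sphi k : smooth (phi k) by exact: smoothM.
have phi'E k t : derive1 (phi k) t = psi t * s' k t + s k t * derive1 psi t.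
  rewrite derive1E; have dpsi := smooth_is_derive t spsi.
  by rewrite (@derive_val _ _ _ _ _ _ _ (is_deriveM dpsi (s'E k t))).
have Phi k : test_function a b (phi k).
  pose J := `[c + (u k)^-1, d - (u k)^-1]%classic.
  have phiJ : closure [set t | phi k t != 0] `<=` J.
    rewrite closureE; apply: bigcap_inf; split; first exact: itv_closed.
    move=> t /=; apply: contraNT; rewrite in_itv/= negb_and -!ltNge => tJ.
    rewrite /phi; suff -> : s k t = 0 by rewrite mulr0.
    case/orP: tJ => tJ.
      by apply: (eL k t _).1; rewrite -ler_pdivlMl// mulr1; lra.
    by apply: (eR k t _).1; rewrite -ler_pdivrMl// mulrN1; lra.
  split.
  - by move=> m x; exact: smooth_derivable.
  - apply: (subclosed_compact _ _ phiJ); first exact: closed_closure.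
    exact: segment_compact.
  - apply: (subset_trans phiJ) => t /=; rewrite !in_itv/= => /andP[t1 t2].
    move: t1 t2; rewrite !bnd_simp => t1 t2.
    have ui : 0 < (u k)^-1 by rewrite invr_gt0.
    move: (u k)^-1 ui t1 t2 => ui ui0 t1 t2.
    by apply/andP; split; lra.
have intE F : (forall t, ~ (c < t < d) -> F t = 0) ->
    \int[mu]_(t in `]a, b[) F t = \int[mu]_(t in `[c, d]) F t.
  move=> F0; rewrite (@Rintegral_supported _ `]a, b[ `]c, d[); first last.
  - by move=> t _; rewrite /= in_itv/= => /F0.
  - by move=> t /=; rewrite !in_itv/= => /andP[? ?]; apply/andP; split; lra.
  rewrite [RHS](@Rintegral_supported _ `[c, d] `]c, d[)//.
  - exact: subset_itv_oo_cc.
  - by move=> t _; rewrite /= in_itv/= => /F0.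
have out k t : ~ (c < t < d) -> s k t = 0 /\ s' k t = 0.
  move=> /negP; rewrite negb_and -!leNgt => /orP[tc|td].
    by apply: eL; have := mulr_ge0_le0 (ltW (u0 k)) (_ : t - c <= 0); lra.
  by apply: eR; have := mulr_ge0 (ltW (u0 k)) (_ : 0 <= t - d); lra.
have cs k : {within `[c, d], continuous (s k)}.
  by apply: continuous_subspaceT; exact: smooth_continuous.
pose v t := f t * psi t.
have cv : {within `[c, d], continuous v}.
  by move=> t; apply: continuousM; [exact: cf|exact: cpsi].
pose q t := g t * psi t + f t * derive1 psi t.
have iq : mu.-integrable `[c, d] (EFin \o q).
  have i1 := integrable_continuousM cpsi ig.
  have i2 := integrable_continuousM cpsi' (within_continuous_integrable cf).
  exact: (integrableD _ i1 i2).
have cstep' (x y : R) : {within `[c, d], continuous (step' x y)}.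
  by apply: continuous_subspaceT; exact: continuous_step'.
have ivstep' (x y : R) :
    mu.-integrable `[c, d] (EFin \o (fun t => v t * step' x y t)).
  apply: integrable_continuousM; first exact: cstep'.
  exact: within_continuous_integrable.
(* the weak derivative tested against [phi k], with the terms regrouped *)
have balance k : \int[mu]_(t in `[c, d]) (q t * s k t) =
    \int[mu]_(t in `[c, d]) (v t * step' (u k) (v2 k) t) -
    \int[mu]_(t in `[c, d]) (v t * step' (u k) (v1 k) t).
  have iqs : mu.-integrable `[c, d] (EFin \o (fun t => q t * s k t)).
    exact: integrable_continuousM.
  have wf := fg _ (Phi k); rewrite !intE in wf; first last.
  - by move=> t /out-/(_ k)[s0 s'0]; rewrite phi'E s0 s'0 mul0r mulr0 addr0 mulr0.
  - by move=> t /out-/(_ k)[s0 s'0]; rewrite /phi s0 !mulr0.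
  have igphi : mu.-integrable `[c, d] (EFin \o (fun t => g t * phi k t)).
    apply: integrable_continuousM => //; apply: continuous_subspaceT.
    exact: smooth_continuous.
  have ifphi : mu.-integrable `[c, d] (EFin \o (fun t => f t * derive1 (phi k) t)).
    apply: integrable_continuousM; last exact: within_continuous_integrable.
    apply: continuous_subspaceT; apply: smooth_continuous.
    exact: smooth_derive1.
  have := ivstep' (u k) (v1 k) => i1; have := ivstep' (u k) (v2 k) => i2.
  have i12 : mu.-integrable `[c, d] (EFin \o (fun t =>
      v t * step' (u k) (v2 k) t - v t * step' (u k) (v1 k) t)).
    exact: (integrableB _ i2 i1).
  have i3 : mu.-integrable `[c, d] (EFin \o (fun t => f t * derive1 (phi k) t +
      (v t * step' (u k) (v2 k) t - v t * step' (u k) (v1 k) t))).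
    exact: (integrableD _ ifphi i12).
  transitivity (\int[mu]_(t in `[c, d]) (g t * phi k t + (f t * derive1 (phi k) t +
      (v t * step' (u k) (v2 k) t - v t * step' (u k) (v1 k) t)))).
    by apply: eq_Rintegral => t _; rewrite phi'E /q /phi /v /s'; ring.
  by rewrite RintegralD// RintegralD// RintegralB// wf addrA subrr add0r.
have u_large delta : 0 < delta -> \forall k \near \oo, 2 <= u k * delta.
  move=> delta0; near=> k.
  have : 2 * (d - c) / delta <= k%:R by near: k; exact: nbhs_infty_ger.
  rewrite ler_pdivrMr// => kd; rewrite /u mulrAC ler_pdivlMr//.
  by apply: (le_trans kd); rewrite ler_pM2r// lerDl.
have lim1 : \int[mu]_(t in `[c, d]) (v t * step' (u k) (v1 k) t) @[k --> \oo] --> v c.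
  apply: (@approximate_identity _ _ _ _ _ (fun k => step' (u k) (v1 k))) => //.
  - by rewrite lexx ltW.
  - by move=> k t; rewrite mulr_ge0 ?smooth_step'_ge0// ltW.
  - move=> k; apply: Rintegral_step' => //.
    + by rewrite e1 subrr; lra.
    + by rewrite e1 ucd; have := k0 k; lra.
  - move=> delta delta0; near=> k => t /andP[ct td].
    rewrite ger0_norm ?subr_ge0// => tc.
    rewrite /step' e1 smooth_step'_ge1_eq0 ?mulr0//.
    have : u k * delta <= u k * (t - c) by rewrite ler_pM2l.
    have : 2 <= u k * delta by near: k; exact: u_large.
    by lra.
have lim2 : \int[mu]_(t in `[c, d]) (v t * step' (u k) (v2 k) t) @[k --> \oo] --> v d.
  apply: (@approximate_identity _ _ _ _ _ (fun k => step' (u k) (v2 k))) => //.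
  - by rewrite lexx ltW.
  - by move=> k t; rewrite mulr_ge0 ?smooth_step'_ge0// ltW.
  - move=> k; apply: Rintegral_step' => //.
    + by rewrite e2; have := ucd k; have := k0 k; lra.
    + by rewrite e2 subrr; lra.
  - move=> delta delta0; near=> k => t /andP[ct td].
    rewrite ler0_norm ?subr_le0// opprB => tc.
    rewrite /step' e2 smooth_step'_le0_eq0 ?mulr0//.
    have : u k * delta <= u k * (d - t) by rewrite ler_pM2l.
    have : 2 <= u k * delta by near: k; exact: u_large.
    by lra.
have lim3 : \int[mu]_(t in `[c, d]) (q t * s k t) @[k --> \oo] -->
    \int[mu]_(t in `]c, d[) q t.
  have iqoo := integrable_oo iq.
  under eq_fun do rewrite -Rintegral_oo_cc ?integrable_continuousM//.
  apply: fine_cvg; rewrite fineK ?integrable_fin_num//.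
  apply: (@dominated_cvg _ _ _ mu _ _ _ _ (fun t => `|(q t)%:E|%E)) => //.
  - move=> k; apply/measurable_EFinP; apply: measurable_funM.
      by apply/measurable_EFinP; case/integrableP: iqoo.
    apply: measurable_funTS; apply: continuous_measurable_fun.
    exact: smooth_continuous.
  - move=> t; rewrite /= in_itv/= => /andP[ct td].
    apply/cvg_EFin; first exact: nearW.
    apply: cvg_near_cst; near=> k.
    have tc2 : 2 <= u k * (t - c) by near: k; apply: u_large; rewrite subr_gt0.
    have dt2 : 2 <= u k * (d - t) by near: k; apply: u_large; rewrite subr_gt0.
    rewrite /= /s /step e1 e2 smooth_step_ge1 ?smooth_step_le0 ?subr0 ?mulr1//; lra.
  - exact: integrable_abse.
  - move=> k t _; rewrite /= lee_fin normrM ler_piMr// ler_norml.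
    have := @smooth_step_ge0 R; have := @smooth_step_le1 R => S1 S0.
    rewrite /s /step; have := S1 (u k * t + v1 k); have := S0 (u k * t + v1 k).
    have := S1 (u k * t + v2 k); have := S0 (u k * t + v2 k) => *.
    by apply/andP; split; lra.
have lim4 : \int[mu]_(t in `[c, d]) (q t * s k t) @[k --> \oo] --> v d - v c.
  by under eq_fun do rewrite balance; exact: cvgB lim2 lim1.
exact: (cvg_unique (@Rhausdorff R) lim3 lim4).
Unshelve. all: by end_near.
Qed.
End WeakDerivative.

(** * The Sobolev space of the uniform distribution *)

Section UniformIntegrals.
Context {R : realType} (a b : R) (ab : a < b).
Implicit Types (f g h : R -> R).
Local Notation mu := (@lebesgue_measure R).
Local Notation P := (uniform_prob ab).

Lemma uniform_integrableP f : measurable_fun setT f ->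
  P.-integrable setT (EFin \o f) <-> mu.-integrable `[a, b] (EFin \o f).
Proof.
move=> mf.
have mef : measurable_fun setT (EFin \o f) by exact/measurable_EFinP.
have ba0 : 0 < (b - a)^-1 by rewrite invr_gt0 subr_gt0.
have E : (\int[P]_x `|(EFin \o f) x| =
    (b - a)^-1%:E * \int[mu]_(x in `[a, b]) `|(EFin \o f) x|)%E.
  by rewrite integral_uniform//; exact: measurableT_comp.
split=> /integrableP[_ fi]; apply/integrableP; split => //.
- exact: measurable_funTS.
- move: fi; rewrite E; case: (integral _ _ _) => [r| |]//.
  + by move=> _; rewrite ltry.
  + by rewrite gt0_muley ?lte_fin.
- by rewrite E lte_mul_pinfty// lee_fin ltW.
Qed.

Lemma uniform_Rintegral f : measurable_fun setT f ->
  mu.-integrable `[a, b] (EFin \o f) ->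
  \int[P]_x f x = (b - a)^-1 * \int[mu]_(x in `[a, b]) f x.
Proof.
move=> mf fi; rewrite /Rintegral.
have mef : measurable_fun setT (EFin \o f) by exact/measurable_EFinP.
rewrite (integralE P) (integralE mu) !integral_uniform//; last 2 first.
- exact: measurable_funeneg.
- exact: measurable_funepos.
have fpos : (\int[mu]_(x in `[a, b]) (EFin \o f)^\+ x)%E \is a fin_num.
  exact: integrable_pos_fin_num.
have fneg : (\int[mu]_(x in `[a, b]) (EFin \o f)^\- x)%E \is a fin_num.
  exact: integrable_neg_fin_num.
by rewrite -(fineK fpos) -(fineK fneg) -!EFinM -!EFinB/= mulrBr.
Qed.

Lemma Lfun2_bounded f (M : R) : measurable_fun setT f ->
  (forall x, `|f x| <= M) -> f \in Lfun P 2%:E.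
Proof.
move=> mf fM; rewrite inE; apply/andP; split; rewrite inE//=.
rewrite /finite_norm unlock poweR_lty//.
have M0 : 0 <= M by apply: le_trans (fM 0).
apply: (@le_lt_trans _ _ (\int[P]_x (M `^ 2)%:E)%E).
  apply: ge0_le_integral => //.
  - by move=> x _; rewrite /= lee_fin powR_ge0.
  - apply/measurable_EFinP; apply: (measurableT_comp (measurable_powR _)) => //.
    exact: measurableT_comp.
  - by move=> x _; rewrite lee_fin ge0_ler_powR// nnegrE.
rewrite integral_cst//= probability_setT mule1 ltry//.
Qed.

Lemma Lfun2_measurable f : f \in Lfun P 2%:E -> measurable_fun setT f.
Proof. by rewrite inE => /andP[/[!inE]]. Qed.

Lemma Lfun2_integrableM f g : f \in Lfun P 2%:E -> g \in Lfun P 2%:E ->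
  P.-integrable setT (EFin \o (fun x => f x * g x)).
Proof. by move=> fL gL; apply/Lfun1_integrable; exact: (Lfun2_mul_Lfun1 fL gL). Qed.

Lemma Lfun2_integrable f : f \in Lfun P 2%:E -> P.-integrable setT (EFin \o f).
Proof.
move=> fL; apply/Lfun1_integrable; apply: Lfun_subset12 fL.
exact: fin_num_measure.
Qed.

End UniformIntegrals.

(** * Piecewise smooth functions *)

Section Glue.
Context {R : realType}.
Variables (N : nat) (p : nat -> R).
Hypothesis p_lt : forall j, p j < p j.+1.
Implicit Types (k : nat -> R -> R) (f h : R -> R).
Local Notation mu := (@lebesgue_measure R).

(** The pieces live on half-open intervals.  There are [N.+1] of them rather than
    [N], so that the right endpoint [p N] is covered too. *)
Definition glue k (t : R) : R :=
  \sum_(j < N.+1) \1_(`[p j, p j.+1[%classic) t * k j t.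

Lemma partition_le i j : (i <= j)%N -> p i <= p j.
Proof.
move=> ij; rewrite -(subnK ij); elim: (j - i)%N => [//|m IH].
by rewrite (le_trans IH)// addSn ltW.
Qed.

Lemma glueE k j t : (j <= N)%N -> p j <= t < p j.+1 -> glue k t = k j t.
Proof.
move=> jN /andP[jt tj]; have jN1 : (j < N.+1)%N by [].
rewrite /glue (bigD1 (Ordinal jN1))//= big1 ?addr0; last first.
  move=> i /eqP ij; rewrite indicE memNset ?mul0r//= in_itv/= => /andP[it ti].
  have [ilj|jli|/ord_inj//] := ltngtP i (Ordinal jN1).
  - by have := le_lt_trans (le_trans (partition_le ilj) jt) ti; rewrite ltxx.
  - by have := le_lt_trans (le_trans (partition_le jli) it) tj; rewrite ltxx.
by rewrite indicE mem_set ?mul1r//= in_itv/= jt.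
Qed.

Definition matching k := forall j, (j < N)%N -> k j (p j.+1) = k j.+1 (p j.+1).

Lemma matching_glueE k j t : matching k -> (j < N)%N -> p j <= t <= p j.+1 ->
  glue k t = k j t.
Proof.
move=> mk jN /andP[jt]; rewrite le_eqVlt => /predU1P[->|tj].
  by rewrite mk// (@glueE k j.+1)// lexx p_lt.
by rewrite (@glueE k j) ?jt// ltnW.
Qed.

Lemma measurable_glue k : (forall j, continuous (k j)) ->
  measurable_fun setT (glue k).
Proof.
move=> ck; apply: measurable_sum => j; apply: measurable_funM.
  exact: measurable_indic.
exact: continuous_measurable_fun.
Qed.

Lemma continuous_glue k m : matching k -> (forall j, continuous (k j)) ->
  (m <= N)%N -> {within `[p 0%N, p m], continuous (glue k)}.
Proof.
move=> mk ck; elim: m => [_|m IH mN].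
  by rewrite set_itv1; exact: continuous_subspace1.
have -> : `[p 0%N, p m.+1]%classic = `[p 0%N, p m] `|` `[p m, p m.+1].
  have pm := p_lt m; have p0m := partition_le (leq0n m).
  apply/seteqP; split=> t /=; rewrite !in_itv/=.
    move=> /andP[t0 tm].
    by have [tpm|tpm] := leP t (p m); [left; rewrite t0|right; rewrite ltW].
  by case=> /andP[t0 tm]; apply/andP; split; lra.
apply: withinU_continuous; [exact: itv_closed|exact: itv_closed|exact/IH/ltnW|].
apply: (@subspace_eq_continuous _ _ _ (k m)).
  move=> t; rewrite inE/= in_itv/= /from_subspace => /(matching_glueE mk mN).
  by move=> ->.
exact: continuous_subspaceT.
Qed.

Lemma bounded_glue k : (forall j, continuous (k j)) ->
  exists M, forall t, `|glue k t| <= M.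
Proof.
move=> ck; have kM j : exists M, forall t, p j <= t <= p j.+1 -> `|k j t| <= M.
  have /compact_bounded[M [_ kM]] := continuous_compact
     (continuous_subspaceT (ck j)) (@segment_compact _ (p j) (p j.+1)).
  exists (M + 1) => t tj; apply: (kM (M + 1)); first by rewrite ltrDl.
  by exists t => //=; rewrite in_itv.
have [M kM'] := choice kM.
exists (\sum_(j < N.+1) M j) => t.
rewrite (le_trans (ler_norm_sum _ _ _))//; apply: ler_sum => j _.
rewrite normrM indicE; case: (boolP (t \in _)) => [|_]; last first.
  rewrite normr0 mul0r; apply: le_trans (kM' j (p j) _) => //.
  by rewrite lexx ltW.
by rewrite inE/= in_itv/= normr1 mul1r => /andP[jt tj]; rewrite kM'// jt ltW.
Qed.

Lemma Rintegral_partition f : mu.-integrable `[p 0%N, p N] (EFin \o f) ->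
  \int[mu]_(t in `[p 0%N, p N]) f t =
  \sum_(j < N) \int[mu]_(t in `]p j, p j.+1[) f t.
Proof.
elim: N => [|m IH] fi; first by rewrite big_ord0 set_itv1 Rintegral_set1.
have sub : `[p 0%N, p m] `<=` `[p 0%N, p m.+1].
  by apply: subset_itvl; rewrite bnd_simp ltW.
rewrite big_ord_recr/= -IH; last exact: integrableS fi.
apply/eqP; rewrite addrC -subr_eq; apply/eqP.
rewrite Rintegral_itvB// ?bnd_simp ?partition_le// ?ltW//.
rewrite [RHS]Rintegral_itv_bndo_bndc//.
apply: integrableS fi => // t/=; rewrite !in_itv/= => /andP[mt tm].
by rewrite (le_trans _ (ltW mt)) ?partition_le//= ltW.
Qed.

Lemma integrable_glue k : (forall j, continuous (k j)) ->
  mu.-integrable `[p 0%N, p N] (EFin \o glue k).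
Proof.
move=> ck; apply: measurable_bounded_integrable => //.
- by apply: compact_finite_measure; exact: segment_compact.
- by apply: measurable_funTS; exact: measurable_glue.
- have [M kM] := bounded_glue ck.
  exists M; split; first exact: num_real.
  by move=> x Mx t _ /=; rewrite (le_trans (kM t))// ltW.
Qed.

(** On each piece this is the fundamental theorem of calculus for the product with
    the test function.  The boundary terms telescope because the pieces match, and
    the extreme ones vanish with the test function. *)
Lemma weak_derivative_glue k : matching k -> (forall j, smooth (k j)) ->
  is_weak_derivative (p 0%N) (p N) (glue k) (glue (fun j => derive1 (k j))).
Proof.
move=> mk sk phi [dphi _ phi_supp].
have ck j : continuous (k j) by exact: smooth_continuous.
have ck' j : continuous (derive1 (k j)).
  by apply: smooth_continuous; exact: smooth_derive1.
have dphi0 (t : R) : is_derive t 1 phi (derive1 phi t).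
  by rewrite derive1E; apply: derivableP; exact: (dphi 0%N).
have cphi : continuous phi by move=> t; apply: derivable_continuous_at; exact: (dphi 0%N).
have cphi' : continuous (derive1 phi).
  by move=> t; apply: derivable_continuous_at; exact: (dphi 1%N).
have phi0 t : ~ (p 0%N < t < p N) -> phi t = 0.
  move=> tN; apply/eqP; apply: contra_notT tN => phit.
  by have := phi_supp t; rewrite /= in_itv/=; apply; exact: subset_closure.
have i1 : mu.-integrable `[p 0%N, p N] (EFin \o (fun t => glue k t * derive1 phi t)).
  apply: integrable_continuousM; first exact: continuous_subspaceT.
  exact: integrable_glue.
have i2 : mu.-integrable `[p 0%N, p N]
    (EFin \o (fun t => glue (fun j => derive1 (k j)) t * phi t)).
  apply: integrable_continuousM; first exact: continuous_subspaceT.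
  exact: integrable_glue.
apply/eqP; rewrite -addr_eq0 !Rintegral_oo_cc// !Rintegral_partition//.
rewrite -big_split/=; apply/eqP.
transitivity (\sum_(0 <= j < N) (glue k (p j.+1) * phi (p j.+1) -
                                 glue k (p j) * phi (p j))); last first.
  by rewrite telescope_sumr// !phi0 ?ltxx ?andbF// !mulr0 subrr.
rewrite big_mkord; apply: eq_bigr => -[j jN] _ /=.
have pjj := p_lt j.
rewrite (@matching_glueE k j (p j.+1))// ?lexx ?ltW//.
rewrite (@matching_glueE k j (p j))// ?lexx ?ltW//.
have D (t : R) : is_derive t 1 (fun t => k j t * phi t)
    (k j t * derive1 phi t + phi t * derive1 (k j) t).
  exact: is_deriveM (smooth_is_derive t (sk j)) (dphi0 t).
have cD : continuous (fun t => k j t * derive1 phi t + phi t * derive1 (k j) t).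
  by move=> t; apply: cvgD; apply: cvgM; [exact: ck|exact: cphi'|exact: cphi|exact: ck'].
rewrite -(Rintegral_derivative pjj D cD) -Rintegral_oo_cc; last first.
  by apply: within_continuous_integrable; exact: continuous_subspaceT.
have c1 : continuous (fun t => k j t * derive1 phi t).
  by move=> t; apply: cvgM; [exact: ck|exact: cphi'].
have c2 : continuous (fun t => phi t * derive1 (k j) t).
  by move=> t; apply: cvgM; [exact: cphi|exact: ck'].
have ioo f : continuous f -> mu.-integrable `]p j, p j.+1[ (EFin \o f).
  move=> cf; apply: integrable_oo; apply: within_continuous_integrable.
  exact: continuous_subspaceT.
rewrite RintegralD//; [|exact: ioo|exact: ioo].
congr (_ + _); apply: eq_Rintegral => t; rewrite inE/= in_itv/= => /andP[jt tj].
  by rewrite (@matching_glueE k j)// !ltW.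
by rewrite (@glueE _ j) ?(ltW jt)// 1?mulrC// ltnW.
Qed.

End Glue.

(** * The inner product of the Sobolev space *)

Section H1Product.
Context {R : realType} (a b : R) (ab : a < b).
Implicit Types (f g h : R -> R).
Local Notation mu := (@lebesgue_measure R).
Local Notation P := (uniform_prob ab).

Definition H1_dot f f' g g' : R := \int[P]_t (f t * g t + f' t * g' t).

Lemma H1_dot_integrable f f' g g' : H1 ab f f' -> H1 ab g g' ->
  P.-integrable setT (EFin \o (fun t => f t * g t + f' t * g' t)).
Proof.
move=> [_ fL f'L _] [_ gL g'L _].
exact: (integrableD _ (Lfun2_integrableM fL gL) (Lfun2_integrableM f'L g'L)).
Qed.

Lemma H1_norm_sqr f f' : H1 ab f f' -> H1_norm ab f f' ^+ 2 = H1_dot f f' f f'.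
Proof.
move=> [_ fL f'L _]; rewrite sqr_sqrtr; last first.
  by rewrite addr_ge0//; apply: Rintegral_ge0 => t _; exact: sqr_ge0.
rewrite -RintegralD//; exact: Lfun2_integrable_sqr.
Qed.

(** The quadratic polynomial [s |-> ||s f + g||^2] is nonnegative; it is evaluated
    at its minimum. *)
Lemma H1_Cauchy_Schwarz f f' g g' : H1 ab f f' -> H1 ab g g' ->
  `|H1_dot f f' g g'| <= H1_norm ab f f' * H1_norm ab g g'.
Proof.
move=> Hf Hg; have If := H1_dot_integrable Hf Hf.
have Ifg := H1_dot_integrable Hf Hg; have Ig := H1_dot_integrable Hg Hg.
set A := H1_norm ab f f'; set B := H1_dot _ _ _ _; set C := H1_norm ab g g'.
have A0 : 0 <= A by exact: sqrtr_ge0.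
have C0 : 0 <= C by exact: sqrtr_ge0.
have quad (s : R) : 0 <= s ^+ 2 * A ^+ 2 + (2 * s * B + C ^+ 2).
  have I1 : P.-integrable setT (EFin \o (fun t => s ^+ 2 * (f t * f t + f' t * f' t))).
    exact: (integrableZl _ (s ^+ 2) If).
  have I2 : P.-integrable setT (EFin \o (fun t => 2 * s * (f t * g t + f' t * g' t))).
    exact: (integrableZl _ (2 * s) Ifg).
  have I3 : P.-integrable setT (EFin \o (fun t => 2 * s * (f t * g t + f' t * g' t) +
      (g t * g t + g' t * g' t))) by exact: (integrableD _ I2 Ig).
  rewrite /A /C !H1_norm_sqr// /B /H1_dot -!RintegralZl// -RintegralD// -RintegralD//.
  apply: Rintegral_ge0 => t _ /=.
  rewrite [leRHS](_ : _ = (s * f t + g t) ^+ 2 + (s * f' t + g' t) ^+ 2); last by ring.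
  by rewrite addr_ge0// sqr_ge0.
rewrite -(@ler_pXn2r _ 2)// ?nnegrE ?mulr_ge0// -normrX ger0_norm ?sqr_ge0// exprMn.
have [A00|A00] := eqVneq A 0.
  rewrite A00 expr0n mul0r/=; have [->|B0] := eqVneq B 0; first by rewrite expr0n.
  (* the polynomial is affine: it takes the value [-1] here *)
  have := quad (- (C ^+ 2 + 1) / (2 * B)).
  rewrite A00 expr0n mulr0 add0r (_ : 2 * _ * B = - (C ^+ 2 + 1)); first by lra.
  by field.
have A2 : 0 < A ^+ 2 by rewrite exprn_gt0// lt_neqAle eq_sym A00.
have := quad (- B / A ^+ 2).
rewrite -(pmulr_rge0 _ A2) [leRHS](_ : _ = A ^+ 2 * C ^+ 2 - B ^+ 2) ?subr_ge0//.
by field.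
Qed.

Lemma H1_weak_derivative_integrable f f' : H1 ab f f' -> mu.-integrable `[a, b] (EFin \o f') .
Proof.
move=> [_ _ f'L _]; apply/(uniform_integrableP ab (Lfun2_measurable f'L)).
exact: Lfun2_integrable.
Qed.

Variables (N : nat) (p : nat -> R).
Hypotheses (p_lt : forall j, p j < p j.+1) (p0 : p 0%N = a) (pN : p N = b).

Lemma H1_glue k : matching N p k -> (forall j, smooth (k j)) ->
  H1 ab (glue N p k) (glue N p (fun j => derive1 (k j))).
Proof.
move=> mk sk.
have ck j : continuous (k j) by exact: smooth_continuous.
have ck' j : continuous (derive1 (k j)).
  by apply: smooth_continuous; exact: smooth_derive1.
split.
- by rewrite -p0 -pN; exact: continuous_glue.
- have [M kM] := bounded_glue N p_lt ck.
  by apply: (Lfun2_bounded _ _ kM); exact: measurable_glue.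
- have [M kM] := bounded_glue N p_lt ck'.
  by apply: (Lfun2_bounded _ _ kM); exact: measurable_glue.
- by rewrite -p0 -pN; exact: weak_derivative_glue.
Qed.

(** As [k j] solves [k - k'' = 1], integrating [K' h'] by parts on each piece
    leaves [int h] and boundary terms at the partition points. *)
Lemma H1_dot_glue k h h' : matching N p k -> (forall j, smooth (k j)) ->
  (forall j t, derive1 (derive1 (k j)) t = k j t - 1) -> H1 ab h h' ->
  H1_dot (glue N p k) (glue N p (fun j => derive1 (k j))) h h' =
  \int[P]_t h t + (b - a)^-1 *
    \sum_(j < N) (h (p j.+1) * derive1 (k j) (p j.+1) - h (p j) * derive1 (k j) (p j)).
Proof.
move=> mk sk k'' Hh; have HK := H1_glue mk sk.
have IKh := H1_dot_integrable HK Hh.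
have ih' := H1_weak_derivative_integrable Hh.
have [ch hL h'L wh] := Hh; have mh := Lfun2_measurable hL.
have [_ KL K'L _] := HK.
have mh' := Lfun2_measurable h'L.
have ih := Lfun2_integrable hL.
have ih_ := (uniform_integrableP ab mh).1 ih.
set K := glue _ _ k; set K' := glue _ _ _.
have mKh : measurable_fun setT (fun t => K t * h t + K' t * h' t).
  apply: measurable_funD; apply: measurable_funM => //.
    exact: Lfun2_measurable KL.
  exact: Lfun2_measurable K'L.
have IKh_ := (uniform_integrableP ab mKh).1 IKh.
rewrite /H1_dot !uniform_Rintegral// -mulrDr; congr (_ * _).
apply/eqP; rewrite addrC -subr_eq; apply/eqP; rewrite -RintegralB//.
have Idiff : mu.-integrable `[a, b] (EFin \o (fun t => K t * h t + K' t * h' t - h t)).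
  exact: (integrableB _ IKh_ ih_).
rewrite -{1}p0 -{1}pN Rintegral_partition ?p0 ?pN//.
apply: eq_bigr => -[j jN] _ /=.
rewrite -(weak_integration_by_parts _ (p_lt j) _ ch ih' wh).
- apply: eq_Rintegral => t; rewrite inE/= in_itv/= => /andP[jt tj].
  rewrite /K /K' !(@glueE _ _ _ p_lt _ j) ?(ltW jt)//; [|exact: ltnW..].
  by rewrite k''; ring.
- by rewrite -p0 partition_le.
- by rewrite -pN partition_le.
- exact: smooth_derive1.
Qed.

End H1Product.

(** * The worst-case error of the midpoint rule *)

Section Hyperbolic.
Context {R : realType}.
Implicit Types x : R.

Definition cosh x : R := (expR x + expR (- x)) / 2.
Definition sinh x : R := (expR x - expR (- x)) / 2.

Lemma coshN x : cosh (- x) = cosh x.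
Proof. by rewrite /cosh opprK addrC. Qed.

Lemma sinhN x : sinh (- x) = - sinh x.
Proof. by rewrite /sinh opprK -mulNr opprB. Qed.

Lemma cosh0 : cosh 0 = 1.
Proof. by rewrite /cosh oppr0 expR0 -mulr2n -mulr_natl mulr1 divff. Qed.

Lemma sinh0 : sinh 0 = 0.
Proof. by rewrite /sinh oppr0 subrr mul0r. Qed.

Lemma sinh_gt0 x : 0 < x -> 0 < sinh x.
Proof.
move=> x0; rewrite divr_gt0// subr_gt0 ltr_expR.
by rewrite (lt_trans _ x0)// oppr_lt0.
Qed.

Let is_derive_expRN (x : R) : is_derive x 1 (fun x => expR (- x)) (- expR (- x)).
Proof.
have dN : is_derive x 1 (fun x => - x) (-1 : R).
  exact: is_deriveN (is_derive_id x 1).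
have := @is_derive1_comp _ expR (fun x => - x) x _ _ (is_derive_expR (- x)) dN.
by move=> d; apply: (is_derive_eq d); rewrite mulrN1.
Qed.

#[global] Instance is_derive_cosh (x : R) : is_derive x 1 cosh (sinh x).
Proof.
have d := is_deriveM (is_deriveD (is_derive_expR x) (is_derive_expRN x))
  (is_derive_cst (2^-1 : R) x 1).
apply: (is_derive_eq d).
by rewrite /GRing.scale/= mulr0 add0r mulrC.
Qed.

#[global] Instance is_derive_sinh (x : R) : is_derive x 1 sinh (cosh x).
Proof.
have d := is_deriveM (is_deriveB (is_derive_expR x) (is_derive_expRN x))
  (is_derive_cst (2^-1 : R) x 1).
apply: (is_derive_eq d).
by rewrite /GRing.scale/= mulr0 add0r mulrC opprK.
Qed.

Lemma smooth_cosh : smooth cosh.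
Proof.
apply: smoothM; last exact: smooth_cst.
apply: smoothD; first exact: smooth_expR.
rewrite (_ : (fun _ => _) = fun x => expR (-1 * x + 0)).
  by apply: smooth_affine; exact: smooth_expR.
by apply/funext => x; rewrite mulN1r addr0.
Qed.

End Hyperbolic.

Section MidpointKernel.
Context {R : realType} (a b : R) (ab : a < b) (n : nat) (n_gt0 : (0 < n)%N).
Local Notation mu := (@lebesgue_measure R).
Local Notation P := (uniform_prob ab).

Definition half_width : R := (b - a) / (2 * n%:R).
Local Notation l := half_width.

(** The even half-nodes are the boundaries of the [n] cells, the odd ones are their
    midpoints. *)
Definition half_node (j : nat) : R := a + j%:R * l.
Local Notation p := half_node.

Definition midpoint_rule (h : R -> R) : R := n%:R^-1 * \sum_(i < n) h (p i.*2.+1).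

Lemma half_width_gt0 : 0 < l.
Proof. by rewrite divr_gt0 ?subr_gt0// mulr_gt0 ?ltr0n. Qed.

Lemma half_node_lt j : p j < p j.+1.
Proof. by rewrite /p -natr1 mulrDl mul1r addrA ltrDl half_width_gt0. Qed.

Lemma half_node0 : p 0%N = a.
Proof. by rewrite /p mul0r addr0. Qed.

Lemma half_node_last : p n.*2 = b.
Proof.
have n0 : n%:R != 0 :> R by rewrite pnatr_eq0 -lt0n.
by rewrite /p /l -muln2 natrM; field.
Qed.

(** [p (j + odd j)] is the end of the half-cell [[p j, p j.+1]] that is a cell
    boundary; the derivative vanishes there.  The factor [c] scales
    the kernel: [c * k] is again a glueing of smooth pieces, which spares a proof
    that [H^1] is stable under scaling. *)
Definition kernel_piece (c A : R) (j : nat) (t : R) : R :=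
  c * (1 - A * cosh (t - p (j + odd j))).

Lemma is_derive_kernel_piece c A j (t : R) :
  is_derive t 1 (kernel_piece c A j) (- (c * A * sinh (t - p (j + odd j)))).
Proof.
have dB : is_derive t 1 (fun t => t - p (j + odd j)) (1 : R).
  by apply: (is_derive_eq (is_deriveB (is_derive_id t 1)
    (is_derive_cst (p (j + odd j)) t 1))); rewrite subr0.
have dc := @is_derive1_comp _ cosh (fun t => t - p (j + odd j)) t _ _
  (is_derive_cosh _) dB.
have d := is_deriveM (is_derive_cst (c : R) t 1) (is_deriveB (is_derive_cst (1 : R) t 1)
  (is_deriveM (is_derive_cst (A : R) t 1) dc)).
by apply: (is_derive_eq d); rewrite /GRing.scale/=; ring.
Qed.

Lemma derive1_kernel_piece c A j :
  derive1 (kernel_piece c A j) = fun t => - (c * A * sinh (t - p (j + odd j))).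
Proof.
apply/funext => t; rewrite derive1E.
by apply: derive_val; exact: is_derive_kernel_piece.
Qed.

Lemma derive1_derive1_kernel_piece c A j (t : R) :
  derive1 (derive1 (kernel_piece c A j)) t = kernel_piece c A j t - c.
Proof.
rewrite derive1_kernel_piece derive1E.
have dB : is_derive t 1 (fun t => t - p (j + odd j)) (1 : R).
  by apply: (is_derive_eq (is_deriveB (is_derive_id t 1)
    (is_derive_cst (p (j + odd j)) t 1))); rewrite subr0.
have dc := @is_derive1_comp _ sinh (fun t => t - p (j + odd j)) t _ _
  (is_derive_sinh _) dB.
have d := is_deriveN (is_deriveM (is_derive_cst (c * A : R) t 1) dc).
rewrite (@derive_val _ _ _ _ _ _ _ d) /kernel_piece /GRing.scale/=; ring.
Qed.

Lemma smooth_kernel_piece c A j : smooth (kernel_piece c A j).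
Proof.
apply: smoothM; first exact: smooth_cst.
apply: smoothD; first exact: smooth_cst.
rewrite (_ : (fun _ => _) = fun t => (- A) * cosh (1 * t + - p (j + odd j))).
  apply: smoothM; first exact: smooth_cst.
  by apply: smooth_affine; exact: smooth_cosh.
by apply/funext => t; rewrite mul1r mulNr.
Qed.

Let node_right j : p j.+1 - p (j + odd j) = (~~ odd j)%:R * l.
Proof. by rewrite /p -natr1 natrD; case: odd => /=; ring. Qed.

Let node_left j : p j - p (j + odd j) = - ((odd j)%:R * l).
Proof. by rewrite /p natrD; ring. Qed.

Lemma matching_kernel_piece c A : matching n.*2 p (kernel_piece c A).
Proof.
by move=> j _; rewrite /kernel_piece node_right node_left coshN.
Qed.

Definition kernel (c A : R) := glue n.*2 p (kernel_piece c A).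
Definition kernel' (c A : R) := glue n.*2 p (fun j => derive1 (kernel_piece c A j)).

Lemma H1_kernel c A : H1 ab (kernel c A) (kernel' c A).
Proof.
apply: H1_glue.
- exact: half_node_lt.
- exact: half_node0.
- exact: half_node_last.
- exact: matching_kernel_piece.
- by move=> j; exact: smooth_kernel_piece.
Qed.

Lemma kernel_scale c A t : kernel c A t = c * kernel 1 A t.
Proof.
rewrite /kernel /glue mulr_sumr; apply: eq_bigr => j _.
by rewrite /kernel_piece mul1r mulrCA.
Qed.

Lemma kernel'_scale c A t : kernel' c A t = c * kernel' 1 A t.
Proof.
rewrite /kernel' /glue mulr_sumr; apply: eq_bigr => j _.
by rewrite !derive1_kernel_piece; ring.
Qed.

Lemma big_double (F : nat -> R) m :
  \sum_(j < m.*2) F j = \sum_(i < m) (F i.*2 + F i.*2.+1).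
Proof.
elim: m => [|m IH]; first by rewrite !big_ord0.
by rewrite doubleS !big_ord_recr/= IH addrA.
Qed.

(** At a midpoint the derivative of the kernel jumps from [- A sinh l] to
    [A sinh l], so the two half-cells of a cell together contribute
    [- 2 l h], evaluated at the midpoint. *)
Lemma H1_dot_kernel A h h' : A * sinh l = l -> H1 ab h h' ->
  H1_dot ab (kernel 1 A) (kernel' 1 A) h h' = \int[P]_t h t - midpoint_rule h.
Proof.
move=> Al Hh.
have dn2 j (t : R) : derive1 (derive1 (kernel_piece 1 A j)) t = kernel_piece 1 A j t - 1.
  exact: derive1_derive1_kernel_piece.
rewrite /kernel /kernel' (H1_dot_glue half_node_lt half_node0 half_node_last
  (@matching_kernel_piece 1 A) (smooth_kernel_piece 1 A) dn2 Hh).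
congr (_ + _); rewrite (big_double (fun j => h (p j.+1) * derive1 (kernel_piece 1 A j) (p j.+1) -
  h (p j) * derive1 (kernel_piece 1 A j) (p j))).
rewrite (eq_bigr (fun i : 'I_n => - (2 * (A * sinh l)) * h (p i.*2.+1))); last first.
  move=> i _; rewrite !derive1_kernel_piece !node_right !node_left/= odd_double/=.
  by rewrite !mul0r !mul1r oppr0 !sinh0 sinhN; ring.
rewrite Al -mulr_sumr mulrA /midpoint_rule -[RHS]mulNr; congr (_ * _).
have n0 : n%:R != 0 :> R by rewrite pnatr_eq0 -lt0n.
have ba : b - a != 0 by rewrite subr_eq0 gt_eqF.
by rewrite /l; field; rewrite n0.
Qed.

(** The constant [1] is the glueing of a single piece. *)
Lemma H1_one : H1 ab (fun=> 1) (fun=> 0).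
Proof.
split.
- by apply: continuous_subspaceT => t; exact: cst_continuous.
- exact: Lfun_cst.
- exact: Lfun_cst.
- pose q (j : nat) : R := a + j%:R * (b - a).
  have q_lt j : q j < q j.+1.
    by rewrite /q -natr1 mulrDl mul1r addrA ltrDl subr_gt0.
  have q0 : q 0%N = a by rewrite /q mul0r addr0.
  have q1 : q 1%N = b by rewrite /q mul1r addrC subrK.
  pose k (j : nat) (t : R) : R := 1.
  have k1 t : t \in `]a, b[ -> glue 1 q k t = 1.
    by move=> /andP[at_ tb]; rewrite (@glueE _ _ _ q_lt _ 0%N)// q0 q1 ltW.
  have k1' t : t \in `]a, b[ -> glue 1 q (fun j => derive1 (k j)) t = 0.
    move=> /andP[at_ tb]; rewrite (@glueE _ _ _ q_lt _ 0%N)// ?q0 ?q1 ?ltW//.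
    exact: derive1_cst.
  have mk : matching 1 q k by [].
  have := weak_derivative_glue q_lt mk (fun=> smooth_cst 1); rewrite q0 q1.
  move=> W phi tphi; apply: etrans (etrans (W phi tphi) _).
    by apply: eq_Rintegral => t; rewrite inE => /k1 ->.
  by congr (- _); apply: eq_Rintegral => t; rewrite inE => /k1' ->.
Qed.

Let A := l / sinh l.

Let sinh_l0 : sinh l != 0.
Proof. by rewrite gt_eqF// sinh_gt0// half_width_gt0. Qed.

Let Al : A * sinh l = l.
Proof. by rewrite /A divfK. Qed.

Let n_neq0 : n%:R != 0 :> R.
Proof. by rewrite pnatr_eq0 -lt0n. Qed.

(** The integral is the inner product of the kernel with the constant [1], that is
    the error of the rule at [1], which is zero. *)
Lemma Rintegral_kernel : \int[P]_t kernel 1 A t = 0.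
Proof.
transitivity (H1_dot ab (kernel 1 A) (kernel' 1 A) (fun=> 1) (fun=> 0)).
  by apply: eq_Rintegral => t _; rewrite mulr1 mulr0 addr0.
have P1 : \int[P]_t (fun=> 1) t = 1 by rewrite /Rintegral integral_cst//= probability_setT mule1.
rewrite (H1_dot_kernel Al H1_one) P1.
by rewrite /midpoint_rule sumr_const card_ord -mulr_natl mulr1 mulVf// subrr.
Qed.

Lemma H1_dot_kernel_kernel :
  H1_dot ab (kernel 1 A) (kernel' 1 A) (kernel 1 A) (kernel' 1 A) = l / tanh l - 1.
Proof.
rewrite (H1_dot_kernel Al (H1_kernel 1 A)) Rintegral_kernel sub0r /midpoint_rule.
rewrite (eq_bigr (fun=> 1 - A * cosh l)); last first.
  move=> i _; rewrite /kernel (@glueE _ _ _ half_node_lt _ i.*2.+1).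
  - by rewrite /kernel_piece node_left/= odd_double/= !mul1r coshN.
  - by rewrite ltn_double.
  - by rewrite lexx half_node_lt.
rewrite sumr_const card_ord -[X in _ * X]mulr_natl mulKf// opprB; congr (_ - 1).
have e0 : expR l - expR (- l) != 0.
  by apply: contra_neq sinh_l0; rewrite /sinh => ->; rewrite mul0r.
have e1 : expR l + expR (- l) != 0 by rewrite gt_eqF// addr_gt0 ?expR_gt0.
by rewrite /A /tanh /sinh /cosh; field; rewrite e0 e1.
Qed.

(** The error functional is the inner product with the kernel, so its norm is the
    norm [r] of the kernel, attained at the kernel divided by [r].  When [r = 0]
    that quotient is [0] (as [0^-1 = 0]), which still attains the supremum. *)
Lemma wce_midpoint (x w : 'I_n -> R) :
  (forall h, quadrature x w h = midpoint_rule h) ->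
  wce ab x w = (Num.sqrt (l / tanh l - 1))%:E.
Proof.
move=> xw; have HK := H1_kernel 1 A.
have -> : Num.sqrt (l / tanh l - 1) = H1_norm ab (kernel 1 A) (kernel' 1 A).
  by rewrite -H1_dot_kernel_kernel -H1_norm_sqr// sqrtr_sqr ger0_norm// sqrtr_ge0.
set r := H1_norm _ _ _; have r0 : 0 <= r by exact: sqrtr_ge0.
apply/eqP; rewrite eq_le; apply/andP; split.
  apply: ge_ereal_sup => _ [h [h' [Hh h1 ->]]].
  rewrite lee_fin xw -(H1_dot_kernel Al Hh).
  rewrite (le_trans (H1_Cauchy_Schwarz HK Hh))//.
  by rewrite -[leRHS]mulr1 ler_wpM2l.
apply: ereal_sup_ubound; exists (kernel r^-1 A), (kernel' r^-1 A).
have Hr := H1_kernel r^-1 A.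
have IK := H1_dot_integrable HK HK.
have dot_r : H1_dot ab (kernel 1 A) (kernel' 1 A) (kernel 1 A) (kernel' 1 A) = r ^+ 2.
  by rewrite -H1_norm_sqr.
pose F t := kernel 1 A t * kernel 1 A t + kernel' 1 A t * kernel' 1 A t.
split => //.
- have /(expr_le1 (isT : (0 < 2)%N)) <- : 0 <= H1_norm ab (kernel r^-1 A) (kernel' r^-1 A).
    exact: sqrtr_ge0.
  rewrite (H1_norm_sqr Hr).
  have -> : H1_dot ab (kernel r^-1 A) (kernel' r^-1 A) (kernel r^-1 A) (kernel' r^-1 A) =
      \int[P]_t (r^-1 ^+ 2 * F t).
    apply: eq_Rintegral => t _; rewrite (kernel_scale r^-1) (kernel'_scale r^-1) /F.
    by ring.
  rewrite RintegralZl// [X in _ * X]dot_r.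
  by have [->|rn0] := eqVneq r 0; rewrite ?expr0n ?mulr0// -exprMn mulVf// expr1n.
- rewrite xw -(H1_dot_kernel Al Hr); congr EFin.
  have -> : H1_dot ab (kernel 1 A) (kernel' 1 A) (kernel r^-1 A) (kernel' r^-1 A) =
      \int[P]_t (r^-1 * F t).
    apply: eq_Rintegral => t _; rewrite (kernel_scale r^-1) (kernel'_scale r^-1) /F.
    by ring.
  rewrite RintegralZl// [X in _ * X]dot_r.
  have [->|rn0] := eqVneq r 0; first by rewrite invr0 mul0r normr0.
  by rewrite expr2 mulKf// ger0_norm.
Qed.

End MidpointKernel.

(** * The quadrature is the midpoint rule *)

Section Trigonometry.
Context {R : realType}.
Implicit Types (theta : R) (m n : nat).

(** By induction on [n]: cosine is injective on [[0, pi]] and [cos (y - pi)]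
    vanishes with [cos y]. *)
Lemma cos_eq0_le n (y : R) : 0 <= y <= n%:R * pi -> cos y = 0 ->
  exists2 j, (j < n)%N & y = j%:R * pi + pi / 2.
Proof.
elim: n y => [|n IH] y /andP[y0 yn] cy.
  have : y = 0 by apply/eqP; rewrite eq_le y0 andbT; rewrite mul0r in yn.
  by move=> y00; move: cy; rewrite y00 cos0 => /eqP; rewrite oner_eq0.
have pi0 := pi_gt0 R; have [ypi|piy] := leP y pi.
  exists 0%N => //; rewrite mul0r add0r; apply: cos_inj.
  - by rewrite in_itv/= y0.
  - by rewrite in_itv/=; apply/andP; split; lra.
  - by rewrite cy cos_pihalf.
have [||j jn yj] := IH (y - pi).
- by move: yn; rewrite -natr1 => yn; apply/andP; split; lra.
- by have := cosDpi (y - pi); rewrite subrK cy => /esym/eqP; rewrite oppr_eq0 => /eqP.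
- exists j.+1 => //; move: yj => /(congr1 (fun z => z + pi)); rewrite subrK => ->.
  by rewrite -natr1; ring.
Qed.

Lemma sin_natM_eq0 theta m : sin theta = 0 -> sin (m%:R * theta) = 0.
Proof.
move=> s0; elim: m => [|m IH]; first by rewrite mul0r sin0.
by rewrite -natr1 mulrDl mul1r sinD IH s0 mul0r mulr0 addr0.
Qed.

(** The inverse of the mean of [cos (l theta) ^+ 2] over a period. *)
Definition cheb_weight (l : nat) : R := if l == 0%N then 1 else 2.

(** The Dirichlet kernel identity in a form without division. *)
Lemma sum_sqr_cos theta m :
  sin theta * \sum_(l < m.+1) cheb_weight l * cos (l%:R * theta) ^+ 2 =
  m.+1%:R * sin theta + cos (m.+1%:R * theta) * sin (m%:R * theta).
Proof.
elim: m => [|m IH].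
  by rewrite big_ord1 /cheb_weight mul0r cos0 sin0 expr1n !mulr1 mulr0 addr0 mul1r.
rewrite big_ord_recr/= mulrDr IH /cheb_weight/=.
have -> : m.+2%:R * theta = m.+1%:R * theta + theta by rewrite -[in LHS]natr1 mulrDl mul1r.
have -> : m%:R * theta = m.+1%:R * theta - theta by rewrite -[in RHS]natr1 mulrDl mul1r addrK.
rewrite cosD sinB -[m.+2%:R]natr1.
have := sin2cos2 (m.+1%:R * theta).
set c := cos _; set s := sin (_ * _) => s2.
rewrite (_ : (m.+1%:R + 1) * sin theta + (c * cos theta - s * sin theta) * s =
  m.+1%:R * sin theta + sin theta + c * s * cos theta - s ^+ 2 * sin theta); last by ring.
by rewrite s2; ring.
Qed.

Lemma sum_sqr_cos_root n theta : (0 < n)%N -> cos (n%:R * theta) = 0 ->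
  \sum_(l < n) cheb_weight l * cos (l%:R * theta) ^+ 2 = n%:R.
Proof.
case: n => // n _ c0; have s0 : sin theta != 0.
  apply/eqP => /(@sin_natM_eq0 _ n.+1) s0; have := cos2Dsin2 (n.+1%:R * theta).
  by rewrite c0 s0 !expr0n addr0 => /esym/eqP; rewrite oner_eq0.
by apply: (mulfI s0); rewrite sum_sqr_cos c0 mul0r addr0 mulrC.
Qed.

Lemma cosM_sum (k l : nat) theta : (l <= k)%N ->
  cos (k%:R * theta) * cos (l%:R * theta) =
  (cos ((k + l)%N%:R * theta) + cos ((k - l)%N%:R * theta)) / 2.
Proof.
move=> lk; have -> : (k + l)%N%:R * theta = k%:R * theta + l%:R * theta.
  by rewrite natrD mulrDl.
by rewrite natrB// mulrBl cosD cosB; field.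
Qed.

End Trigonometry.

Section GaussChebyshev.
Context {R : realType} (n : nat) (theta w : 'I_n -> R).
Hypothesis n_gt0 : (0 < n)%N.
Hypothesis w_gt0 : forall i, 0 < w i.
Hypothesis moments : forall m, (m <= 2 * n - 1)%N ->
  \sum_(i < n) w i * cos (m%:R * theta i) = (m == 0%N)%:R.

Let C (m : nat) i : R := cos (m%:R * theta i).

(* Products of cosines are sums of cosines, whose moments are known as long as
   [k + l < 2 n]. *)
Let orth_le (k l : nat) : (l <= k <= n)%N -> (l < n)%N ->
  \sum_(i < n) C k i * (w i * C l i) = ((k + l == 0)%N%:R + (k - l == 0)%N%:R) / 2.
Proof.
move=> /andP[lk kn] ln.
rewrite (eq_bigr (fun i => (w i * C (k + l) i + w i * C (k - l) i) / 2)).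
  by rewrite -mulr_suml big_split/= !moments//; lia.
by move=> i _; rewrite mulrCA cosM_sum// mulrA mulrDr.
Qed.

Let orth (k l : nat) : (k <= n)%N -> (l <= n)%N -> (minn k l < n)%N ->
  \sum_(i < n) C k i * (w i * C l i) = (k == l)%:R / cheb_weight l.
Proof.
move=> kn ln kl; rewrite /cheb_weight; have [lk|/ltnW lk] := leqP l k.
  rewrite orth_le ?lk//; last by lia.
  have -> : (k - l == 0)%N = (k == l) by lia.
  have -> : (k + l == 0)%N = (k == l) && (l == 0)%N by lia.
  by case: (k == l); case: (l == 0)%N => /=; rewrite ?mul0r ?add0r ?divr1//; field.
rewrite (eq_bigr (fun i => C l i * (w i * C k i))); last first.
  by move=> i _; rewrite mulrCA [RHS]mulrCA [C k i * _]mulrC.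
rewrite orth_le ?lk//; last by lia.
have -> : (l - k == 0)%N = (k == l) by lia.
have -> : (l + k == 0)%N = (k == l) && (l == 0)%N by lia.
by case: (k == l); case: (l == 0)%N => /=; rewrite ?mul0r ?add0r ?divr1//; field.
Qed.

Let M : 'M[R]_n := \matrix_(k, i) C k i.
Let Minv : 'M[R]_n := \matrix_(i, l) (w i * C l i * cheb_weight l).

Let cheb_weight_neq0 l : cheb_weight l != 0 :> R.
Proof. by rewrite /cheb_weight; case: ifP => _; rewrite ?oner_eq0// pnatr_eq0. Qed.

(* Orthogonality says that [M *m Minv] is the identity, and the matrices are
   square. *)
Let MinvM : Minv *m M = 1%:M.
Proof.
apply: mulmx1C; apply/matrixP => k l; rewrite !mxE.
rewrite (eq_bigr (fun i => C k i * (w i * C l i) * cheb_weight l)); last first.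
  by move=> i _; rewrite !mxE; ring.
have kn := ltn_ord k; have ln := ltn_ord l.
by rewrite -mulr_suml orth ?divfK//; lia.
Qed.

Let MinvME i j : \sum_(l < n) w i * C l i * cheb_weight l * C l j = (i == j)%:R.
Proof.
have := congr1 (fun X : 'M[R]_n => X i j) MinvM; rewrite !mxE => <-.
by apply: eq_bigr => l _; rewrite !mxE.
Qed.

(** The vector [w i * cos (n theta_i)] is orthogonal to the rows of the invertible
    matrix [M], hence zero. *)
Lemma gauss_chebyshev_node j : cos (n%:R * theta j) = 0.
Proof.
have orthn (l : 'I_n) : \sum_(i < n) C n i * (w i * C l i) = 0.
  have ln := ltn_ord l; rewrite orth//; [|lia..].
  by rewrite (gtn_eqF ln) mul0r.
have : w j * C n j = \sum_(i < n) w i * C n i * (j == i)%:R.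
  rewrite (bigD1 j)//= eqxx mulr1 big1 ?addr0// => i ij.
  by rewrite eq_sym (negbTE ij) mulr0.
rewrite (eq_bigr (fun i => \sum_(l < n)
    w j * C l j * cheb_weight l * (C n i * (w i * C l i)))); last first.
  move=> i _; rewrite -MinvME mulr_sumr; apply: eq_bigr => l _; ring.
rewrite exchange_big/= big1 => [/eqP|l _]; last by rewrite -mulr_sumr orthn mulr0.
by rewrite mulf_eq0 gt_eqF//= => /eqP.
Qed.

(** The diagonal entries of [Minv *m M = 1] read
    [w j * sum_l cheb_weight l * cos (l theta_j) ^+ 2 = 1], where the sum is [n]
    because [theta_j] is a zero of [cos (n theta)]. *)
Lemma gauss_chebyshev_weight j : w j = n%:R^-1.
Proof.
have := MinvME j j; rewrite eqxx.
rewrite (eq_bigr (fun l : 'I_n => w j * (cheb_weight l * cos (l%:R * theta j) ^+ 2))).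
  rewrite -mulr_sumr sum_sqr_cos_root// ?gauss_chebyshev_node// => wn.
  have n0 : n%:R != 0 :> R by rewrite pnatr_eq0 -lt0n.
  by apply: (mulIf n0); rewrite wn mulVf.
by move=> l _; rewrite /C; ring.
Qed.

End GaussChebyshev.

Section PoincareQuadrature.
Context {R : realType} (a b : R) (ab : a < b).
Local Notation mu := (@lebesgue_measure R).
Local Notation P := (uniform_prob ab).

Let angle (t : R) : R := pi * ((t - a) / (b - a)).

Let ba0 : b - a != 0. Proof. by rewrite subr_eq0 gt_eqF. Qed.

Lemma Rintegral_poincare_basis m : (0 < m)%N -> \int[P]_t poincare_basis a b m t = 0.
Proof.
move=> m0; have pi0 : pi != 0 :> R by rewrite gt_eqF// pi_gt0.
have mn0 : m%:R != 0 :> R by rewrite pnatr_eq0 -lt0n.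
pose F (t : R) : R := Num.sqrt 2 * ((b - a) / (m%:R * pi)) * sin (m%:R * pi * ((t - a) / (b - a))).
have dF (t : R) : is_derive t 1 F (poincare_basis a b m t).
  have dl : is_derive t 1 (fun t => m%:R * pi * ((t - a) / (b - a))) (m%:R * pi / (b - a)).
    have d := is_deriveM (is_derive_cst (m%:R * pi : R) t 1)
      (is_deriveM (is_deriveB (is_derive_id t 1) (is_derive_cst a t 1))
       (is_derive_cst ((b - a)^-1 : R) t 1)).
    by apply: (is_derive_eq d); rewrite /GRing.scale/=; ring.
  have ds := @is_derive1_comp _ sin _ t _ _ (is_derive_sin _) dl.
  have d := is_deriveM (is_derive_cst (Num.sqrt 2 * ((b - a) / (m%:R * pi)) : R) t 1) ds.
  apply: (is_derive_eq d); rewrite /poincare_basis gtn_eqF// /GRing.scale/=.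
  by move: (@pi R) pi0 => q q0; field; rewrite ba0 mn0 q0.
have cF : continuous (poincare_basis a b m).
  rewrite /poincare_basis gtn_eqF// => t; apply: cvgM; first exact: cvg_cst.
  apply: continuous_cvg; first exact: continuous_cos.
  apply: cvgM; first exact: cvg_cst.
  by apply: cvgM; [apply: cvgB; [exact: cvg_id|exact: cvg_cst]|exact: cvg_cst].
rewrite uniform_Rintegral; last 2 first.
- exact: continuous_measurable_fun.
- by apply: within_continuous_integrable; exact: continuous_subspaceT.
rewrite (Rintegral_derivative ab dF cF) /F subrr mul0r mulr0 sin0 divff// mulr1.
by rewrite sin_natM_eq0 ?sinpi// mulr0 subrr mulr0.
Qed.

Lemma poincare_quadratureE n (x w : 'I_n -> R) : (0 < n)%N ->
  is_poincare_quadrature ab x w ->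
  forall h, quadrature x w h = midpoint_rule a b n h.
Proof.
move=> n0 [x_inj x_ab w0 xw] h.
have n0' : n%:R != 0 :> R by rewrite pnatr_eq0 -lt0n.
have s20 : Num.sqrt 2 != 0 :> R by rewrite sqrtr_eq0 -ltNge.
have mom m : (m <= 2 * n - 1)%N ->
    \sum_(i < n) w i * cos (m%:R * angle (x i)) = (m == 0%N)%:R.
  move=> /xw; rewrite /quadrature; have [->|m0] := eqVneq m 0%N.
    rewrite /poincare_basis/= /Rintegral integral_cst//= probability_setT mule1 => /= E.
    by rewrite [RHS]E; apply: eq_bigr => i _; rewrite mul0r cos0.
  rewrite Rintegral_poincare_basis ?lt0n// => E.
  apply: (mulfI s20); rewrite mulr0 [RHS]E mulr_sumr; apply: eq_bigr => i _.
  by rewrite /poincare_basis (negbTE m0) mulrCA /angle (mulrA m%:R).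
have wn := gauss_chebyshev_weight n0 w0 mom.
have nodes i : exists j : 'I_n, x i = half_node a b n j.*2.+1.
  have := gauss_chebyshev_node n0 w0 mom i => /(@cos_eq0_le _ n)[].
    have /andP[ax xb] := x_ab i; have pi0 := pi_gt0 R.
    have ba : 0 < b - a by rewrite subr_gt0.
    have q0 : 0 <= (x i - a) / (b - a) by rewrite divr_ge0 ?subr_ge0// ltW.
    have q1 : (x i - a) / (b - a) <= 1 by rewrite ler_pdivrMr// mul1r; lra.
    rewrite /angle; apply/andP; split.
      exact: mulr_ge0 (ler0n _ _) (mulr_ge0 (ltW pi0) q0).
    by rewrite ler_wpM2l// ler_piMr// ltW.
  move=> j jn E; exists (Ordinal jn) => /=.
  rewrite /half_node /half_width -natr1 -muln2 natrM.
  have pi0 : pi != 0 :> R by rewrite gt_eqF// pi_gt0.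
  have {E} : n%:R * pi * ((x i - a) / (b - a)) = (j%:R + 2^-1) * pi.
    by rewrite -mulrA E; ring.
  move=> /(congr1 (fun z => z / (n%:R * pi) * (b - a) + a)).
  rewrite (_ : n%:R * pi * _ / _ * _ + _ = x i); last first.
    by move: (@pi R) pi0 => q q0; field; rewrite ba0 n0' q0.
  by move=> ->; move: (@pi R) pi0 => q q0; field; rewrite n0' q0.
(* [n] distinct nodes among [n] midpoints: each midpoint is a node *)
have [s xs] := choice nodes.
have s_inj : injective s.
  by move=> i j ij; apply: x_inj; rewrite !xs ij.
rewrite /quadrature /midpoint_rule [in RHS](reindex_inj s_inj) mulr_sumr.
by apply: eq_bigr => i _; rewrite wn xs.
Qed.

End PoincareQuadrature.

(** * Asymptotics *)

Section Asymptotics.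
Context {R : realType}.
Implicit Types (f : R -> R) (x : R).

Let ge0_of_derive f f' : f 0 = 0 -> (forall x : R, is_derive x 1 f (f' x)) ->
  (forall x, 0 <= x -> 0 <= f' x) -> forall x, 0 <= x -> 0 <= f x.
Proof.
move=> f0 ff' f'0 x x0.
have cf : {within `[0, x], continuous f}.
  by apply: continuous_subspaceT => t; apply: derivable_continuous_at; exact: ex_derive.
have [c] := MVT_segment x0 (fun t _ => ff' t) cf.
rewrite in_itv/= f0 !subr0 => /andP[c0 _] ->.
by rewrite mulr_ge0// f'0.
Qed.

Lemma cosh_ge1 x : 0 <= x -> 1 <= cosh x.
Proof.
move=> x0; rewrite -subr_ge0.
apply: (@ge0_of_derive (fun x => cosh x - 1) (@sinh R)) x0.
- by rewrite cosh0 subrr.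
- by move=> t; apply: (is_derive_eq (is_deriveB (is_derive_cosh t)
    (is_derive_cst (1 : R) t 1))); rewrite subr0.
- by move=> t; rewrite le_eqVlt => /predU1P[<-|/sinh_gt0/ltW//]; rewrite sinh0.
Qed.

Lemma sinh_ge x : 0 <= x -> x <= sinh x.
Proof.
move=> x0; rewrite -subr_ge0.
apply: (@ge0_of_derive (fun x => sinh x - x) (fun x => cosh x - 1)) x0.
- by rewrite sinh0 subrr.
- by move=> t /cosh_ge1; rewrite subr_ge0.
Qed.

Let is_derive_xcosh_sinh (x : R) :
  is_derive x 1 (fun x => x * cosh x - sinh x) (x * sinh x).
Proof.
have d := is_deriveB (is_deriveM (is_derive_id x 1) (is_derive_cosh x)) (is_derive_sinh x).
by apply: (is_derive_eq d); rewrite /GRing.scale/=; ring.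
Qed.

Let is_derive_cube (x : R) : is_derive x 1 (fun x => x * x * x / 3) (x ^+ 2).
Proof.
have i := is_derive_id x (1 : R).
have d2 : is_derive x 1 (fun x => x * x) (x + x).
  by apply: (is_derive_eq (is_deriveM i i)); rewrite /GRing.scale/= mulr1.
have d3 : is_derive x 1 (fun x => x * x * x) (x * x + x * (x + x)).
  by apply: (is_derive_eq (is_deriveM d2 i)); rewrite /GRing.scale/= mulr1.
have d := is_deriveM d3 (is_derive_cst (3^-1 : R) x 1).
by apply: (is_derive_eq d); rewrite /GRing.scale/=; field.
Qed.

Lemma sinh_le_xcosh x : 0 <= x -> sinh x <= x * cosh x.
Proof.
move=> x0; rewrite -subr_ge0.
apply: (@ge0_of_derive (fun x => x * cosh x - sinh x) (fun x => x * sinh x)) x0 => //.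
- by rewrite sinh0 mul0r subrr.
- by move=> t t0; rewrite mulr_ge0// (le_trans t0)// sinh_ge.
Qed.

Lemma cube_le_xcosh_sinh x : 0 <= x -> x * x * x / 3 <= x * cosh x - sinh x.
Proof.
move=> x0; rewrite -subr_ge0.
apply: (@ge0_of_derive (fun x => x * cosh x - sinh x - x * x * x / 3)
  (fun x => x * sinh x - x ^+ 2)) x0.
- by rewrite sinh0 !mul0r !subrr.
- by move=> t; have d := is_deriveB (is_derive_xcosh_sinh t) (is_derive_cube t);
  apply: (is_derive_eq d).
- by move=> t t0; rewrite expr2 -mulrBr mulr_ge0// subr_ge0 sinh_ge.
Qed.

Lemma xcosh_sinh_le_cube x : 0 <= x -> x * cosh x - sinh x <= x * x * x / 3 * cosh x.
Proof.
move=> x0; rewrite -subr_ge0.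
apply: (@ge0_of_derive (fun x => x * x * x / 3 * cosh x - (x * cosh x - sinh x))
  (fun x => x * x * x / 3 * sinh x + x * (x * cosh x - sinh x))) x0.
- by rewrite sinh0 !mul0r !subrr.
- move=> t; have d := is_deriveB (is_deriveM (is_derive_cube t) (is_derive_cosh t))
    (is_derive_xcosh_sinh t).
  by apply: (is_derive_eq d); rewrite /GRing.scale/=; ring.
- move=> t t0; have s0 : 0 <= sinh t by rewrite (le_trans t0)// sinh_ge.
  apply: addr_ge0; first by rewrite mulr_ge0// divr_ge0// !mulr_ge0.
  by rewrite mulr_ge0// subr_ge0 sinh_le_xcosh.
Qed.

Lemma tanhE x : tanh x = sinh x / cosh x.
Proof.
have e1 : expR x + expR (- x) != 0 by rewrite gt_eqF// addr_gt0 ?expR_gt0.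
by rewrite /tanh /sinh /cosh; field.
Qed.

(** Both bounds come from comparing [x cosh x - sinh x] with [x^3 / 3]. *)
Lemma coth_bounds x : 0 < x ->
  (cosh x)^-1 <= 3 * (x / tanh x - 1) / x ^+ 2 <= cosh x.
Proof.
move=> x0; have s0 := sinh_gt0 x0.
have c0 : 0 < cosh x by rewrite (lt_le_trans _ (cosh_ge1 (ltW x0))).
have -> : 3 * (x / tanh x - 1) / x ^+ 2 =
    3 * (x * cosh x - sinh x) / (x ^+ 2 * sinh x).
  by rewrite tanhE; field; rewrite !gt_eqF.
have D0 : 0 < x ^+ 2 * sinh x by rewrite mulr_gt0// exprn_gt0.
have x20 : 0 <= x ^+ 2 by exact: sqr_ge0.
apply/andP; split.
  rewrite ler_pdivlMr// ler_pdivrMl//.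
  have lb := cube_le_xcosh_sinh (ltW x0); have sx := sinh_le_xcosh (ltW x0).
  have : x ^+ 2 * sinh x <= x ^+ 2 * (x * cosh x) by rewrite ler_wpM2l.
  have : cosh x * (x * x * x / 3) <= cosh x * (x * cosh x - sinh x).
    by rewrite ler_wpM2l// ltW.
  by lra.
rewrite ler_pdivrMr//.
have ub := xcosh_sinh_le_cube (ltW x0); have sx := sinh_ge (ltW x0).
have : x ^+ 2 * x <= x ^+ 2 * sinh x by rewrite ler_wpM2l.
move=> /(ler_wpM2l (ltW c0)); lra.
Qed.

Lemma cvg_sqrt_coth (l : nat -> R) : (\forall n \near \oo, 0 < l n) ->
  l n @[n --> \oo] --> 0 ->
  Num.sqrt (3 * (l n / tanh (l n) - 1) / l n ^+ 2) @[n --> \oo] --> (1 : R).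
Proof.
move=> l_gt0 l0.
have cc : cosh (l n) @[n --> \oo] --> (1 : R).
  rewrite -cosh0; apply: continuous_cvg => //.
  exact/(smooth_continuous smooth_cosh).
have cV : (cosh (l n))^-1 @[n --> \oo] --> (1 : R).
  by rewrite -[X in _ --> X]invr1; apply: cvgV => //; exact: oner_neq0.
have cu : 3 * (l n / tanh (l n) - 1) / l n ^+ 2 @[n --> \oo] --> (1 : R).
  by apply: (squeeze_cvgr _ cV cc); near=> n; apply: coth_bounds; near: n.
by rewrite -[X in _ --> X]sqrtr1; exact: (cvg_comp _ _ cu (@sqrt_continuous R 1)).
Unshelve. all: by end_near. Qed.

End Asymptotics.

Unset Implicit Arguments.

Theorem proposition12 (R : realType) (a b : R) (ab : a < b)
    (x w : forall n : nat, 'I_n -> R)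
    (hxw : forall n : nat, (1 <= n)%N ->
       is_poincare_quadrature ab (x n) (w n)) :
  (forall n : nat, (1 <= n)%N ->
     wce ab (x n) (w n) =
     (Num.sqrt ((b - a) / (2 * n%:R) / tanh ((b - a) / (2 * n%:R)) - 1))%:E) /\
  (fun n : nat => fine (wce ab (x n) (w n)) /
                  ((b - a) / (2 * Num.sqrt 3) * (1 / n%:R)))
    @ \oo --> (1 : R).
Proof.
have wceE n : (1 <= n)%N -> wce ab (x n) (w n) =
    (Num.sqrt ((b - a) / (2 * n%:R) / tanh ((b - a) / (2 * n%:R)) - 1))%:E.
  move=> n0; apply: wce_midpoint => //.
  exact: poincare_quadratureE (hxw n n0).
split => //.
pose l (n : nat) := half_width a b n.
have l_gt0 : \forall n \near \oo, 0 < l n.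
  by near=> n; apply: half_width_gt0 => //; near: n; exact: nbhs_infty_gt.
have l0 : l n @[n --> \oo] --> 0.
  rewrite (_ : l = fun n => (b - a) / 2 * n%:R^-1); last first.
    by apply/funext => n; rewrite /l /half_width invfM mulrA.
  rewrite -[X in _ --> X](mulr0 ((b - a) / 2)); apply: cvgM; first exact: cvg_cst.
  apply/gtr0_cvgV0; last exact: cvgr_idn.
  by near=> n; rewrite ltr0n; near: n; exact: nbhs_infty_gt.
apply: cvg_trans (cvg_sqrt_coth l_gt0 l0); apply: near_eq_cvg.
near=> n; have n0 : (0 < n)%N by near: n; exact: nbhs_infty_gt.
have ln0 : 0 < l n by exact: half_width_gt0.
rewrite wceE//= -/(half_width a b n) -/(l n).
have s30 : Num.sqrt 3 != 0 :> R by rewrite sqrtr_eq0 -ltNge.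
have n0' : n%:R != 0 :> R by rewrite pnatr_eq0 -lt0n.
have -> : (b - a) / (2 * Num.sqrt 3) * (1 / n%:R) = l n / Num.sqrt 3.
  by rewrite /l /half_width; field; rewrite s30 n0'.
have -> : Num.sqrt (3 * (l n / tanh (l n) - 1) / l n ^+ 2) =
    (l n)^-1 * (Num.sqrt 3 * Num.sqrt (l n / tanh (l n) - 1)).
  rewrite mulrC sqrtrM ?invr_ge0 ?sqr_ge0// sqrtrM// sqrtrV ?sqr_ge0//.
  by rewrite sqrtr_sqr gtr0_norm.
by move: (l n) ln0 => y y0; field; rewrite s30 gt_eqF.
Unshelve. all: by end_near.
Qed.
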